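(* Let $r=r(n)\ge\log n$ and $G\in\mathcal{T}(n,r)$. Let $\mathcal B_R$ be the closed $d_T$-ball of radius $r/3$ centered at the point $(\sqrt n/2,\sqrt n/2)$. Then a.a.s. $G$ has the following property: in the localization game on $G$ in which the cops use fewer than $10^{-4}\,r^{4/3}/(\log n)^{1/3}$ sensors in each round, the robber has a strategy that stays in $\mathcal B_R$ during the entire game and is never located by the cops.
   Context: The torus $T_n$ is $[0,\sqrt n]^2$ with opposite sides identified, with induced flat metric $d_T$. $G\in\mathcal{T}(n,r)$ has as vertices $n$ independent uniform random points of $T_n$ (identified with positions), distinct vertices adjacent iff their $d_T$-distance is at most $r$; a.a.s. means with probability tending to $1$ as $n\to\infty$; $\log$ is natural. Localization game with $k$ sensors: each round the cops choose $k$ vertices, the robber (invisible to the cops but knowing the graph and all their choices) moves to a neighbour or stays (in the first round she chooses any vertex), the cops learn the graph distances from their chosen vertices to the robber's current vertex, and they locate her when all information collected so far determines her current vertex.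
   Formalization: The number k of sensors per round is also required to satisfy k ≤ n−2: for very large r (e.g. r = n) the stated bound exceeds n, and n−1 distinct sensors locate the robber in the first round on any n-vertex graph. *)

(* Defs.v *)
From HB Require Import structures.
From mathcomp Require Import all_boot all_order all_algebra.
From mathcomp Require Import all_classical all_reals all_analysis.

Set Implicit Arguments.
Unset Strict Implicit.
Unset Printing Implicit Defensive.

Import Order.TTheory GRing.Theory Num.Theory.
Import numFieldNormedType.Exports.

Local Open Scope classical_set_scope.
Local Open Scope ring_scope.

Section GraphDistance.
Variables (T : finType) (e : rel T).

Definition has_walk (x y : T) (m : nat) : bool :=
  [exists p : m.-tuple T, path e x p && (last x p == y)].

(* None stands for an infinite distance. *)
Definition graph_dist (x y : T) : option nat :=
  if pselect (exists m, has_walk x y m) is left xy then Some (ex_minn xy)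
  else None.

End GraphDistance.

Section LocalizationGame.
Variables (T : finType) (e : rel T) (k : nat).

(* The sensors of a round may coincide, so that using fewer than k of them is
   also allowed. *)
Definition sensors := (k.-tuple T)%type.

(* One round: the sensors chosen, and the robber's vertex after her move. *)
Definition round := (sensors * T)%type.

Definition answer (S : sensors) (v : T) : k.-tuple (option nat) :=
  [tuple of [seq graph_dist e s v | s <- S]].

(* What the cops know after the rounds h. *)
Definition cop_info (h : seq round) : seq (sensors * k.-tuple (option nat)) :=
  [seq (x.1, answer x.1 x.2) | x <- h].

Definition cop_strategy :=
  seq (sensors * k.-tuple (option nat)) -> sensors.

(* The robber moves after the sensors of the current round are chosen: the
   argument lists all choices made so far, the current one last.  Her own past
   positions are determined by it. *)
Definition robber_strategy := seq sensors -> T.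

Fixpoint play (c : cop_strategy) (rho : robber_strategy) (t : nat)
  : seq round :=
  if t is t'.+1 then
    let h := play c rho t' in
    let S := c (cop_info h) in
    rcons h (S, rho (rcons (unzip1 h) S))
  else [::].

Definition robber_walk (w : seq T) : bool :=
  sorted (fun u v => (u == v) || e u v) w.

Definition compatible (h : seq round) (w : seq T) : Prop :=
  [/\ size w = size h, robber_walk w
    & cop_info (zip (unzip1 h) w) = cop_info h].

Definition located (h : seq round) : Prop :=
  exists v : T, forall w u, compatible h (rcons w u) -> u = v.

Definition robber_evades_within (B : set T) : Prop :=
  exists rho : robber_strategy, forall (c : cop_strategy) (t : nat),
    let h := play c rho t.+1 in
    [/\ robber_walk (unzip2 h),
        forall v, v \in unzip2 h -> B v
      & ~ located h].

End LocalizationGame.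

Section Torus.
Variable R : realType.

(* Flat metric of the quotient of the plane by the lattice (s Z)^2; points are
   given by arbitrary representatives. *)
Definition torus_dist (s : R) (p q : R * R) : R :=
  inf [set Num.sqrt ((p.1 - q.1 + z.1%:~R * s) ^+ 2
                     + (p.2 - q.2 + z.2%:~R * s) ^+ 2)
      | z in [set: int * int]].

Definition torus_side (n : nat) : R := Num.sqrt n%:R.

Definition torus_square (n : nat) : set (R * R) :=
  `[0, torus_side n] `*` `[0, torus_side n].

Definition torus_ball (n : nat) (c : R * R) (rad : R) : set (R * R) :=
  [set p | torus_dist (torus_side n) c p <= rad].

Definition torus_center (n : nat) : R * R :=
  (torus_side n / 2, torus_side n / 2).

(* Vertices are the indices of the points x. *)
Definition torus_graph (n : nat) (r : R) (x : 'I_n -> R * R) : rel 'I_n :=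
  fun i j => (i != j) && (torus_dist (torus_side n) (x i) (x j) <= r).

End Torus.

Section Probability.
Variables (R : realType) (d : measure_display) (Omega : measurableType d).
Variable P : probability Omega R.

Definition mutually_independent (d' : measure_display) (E : measurableType d')
    (n : nat) (X : 'I_n -> {mfun Omega >-> E}) : Prop :=
  forall A : 'I_n -> set E, (forall i, measurable (A i)) ->
    P (\bigcap_(i in [set: 'I_n]) (X i @^-1` A i))
    = (\prod_(i < n) P (X i @^-1` A i))%E.

Definition area : set (R * R) -> \bar R :=
  (@lebesgue_measure R \x @lebesgue_measure R)%E.

Definition uniform_on (D : set (R * R)) (X : {mfun Omega >-> (R * R)%type})
  : Prop :=
  forall A : set (R * R), measurable A ->
    P (X @^-1` A) = (area (A `&` D) * ((fine (area D))^-1)%:E)%E.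

End Probability.

Definition aas (R : realType) (d : nat -> measure_display)
    (Omega : forall n, measurableType (d n))
    (P : forall n, probability (Omega n) R)
    (A : forall n, set (Omega n)) : Prop :=
  (forall n, measurable (A n)) /\
  (fun n => P n (A n)) @ \oo --> 1%E.

(* Main.v *)
Require Import Defs.
From HB Require Import structures.
From mathcomp Require Import all_boot all_order all_algebra.
From mathcomp Require Import all_classical all_reals all_analysis.
From mathcomp Require Import measurable_realfun.
From mathcomp Require Import ring lra zify.

Set Implicit Arguments.
Unset Strict Implicit.
Unset Printing Implicit Defensive.

Import Order.TTheory GRing.Theory Num.Theory.
Import numFieldNormedType.Exports.

Local Open Scope classical_set_scope.
Local Open Scope ring_scope.

(** The vertices in a centred square B of side r/5 form a clique inside B_R, so
    the robber can jump anywhere in B, and she survives as soon as, for every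
    choice of k sensors, two vertices of B get the same answers.  Cut B into
    K x K cells of side eps ~ (log n / r)^(1/3) / 2 and look for such a pair
    inside one cell.

    Since B is a clique, a sensor outside B sees only two distances m, m+1 in B,
    and the vertices at distance m are those covered by the discs of radius r
    around vertices reached in m - 1 steps outside B.  A union of discs of radius
    r has a boundary of length O(r) in B, so it cuts at most 12 K cells ("mixed"
    cells).  The mixed cells depend only on the points outside B, hence are
    independent of the points inside; a union bound shows that with high
    probability no sensor has more than about 8 log n mixed cells with two
    points.  On the other hand, by Chebyshev's inequality the total number of
    cells with two points exceeds k times that bound: we count the cells hit by
    both halves of the vertices, since hitting events are negatively correlated.
    If r >= 5 sqrt n, the graph is complete and B_R is the whole torus. *)

(** * The game on a clique *)

Section Game.
Variables (T : finType) (e : rel T).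

Lemma clique_robber_walk (B : set T) (w : seq T) :
  (forall u v, B u -> B v -> (u == v) || e u v) ->
  (forall v, v \in w -> B v) -> robber_walk e w.
Proof.
move=> clq; case: w => [//|x w]; rewrite /robber_walk /=.
elim: w x => [//|y w IH] x hw /=.
apply/andP; split; first by apply: clq; apply: hw; rewrite !inE eqxx ?orbT.
by apply: IH => v hv; apply: hw; rewrite inE hv orbT.
Qed.

(** Inside a clique every jump is a legal move, so the past does not restrict the robber: after the
    sensors are announced she goes to one of two twins with equal answers. Exchanging the twins in
    the last round gives another compatible walk, so her position is never determined. *)
Lemma clique_evades k (B : set T) (x0 : T) :
  (forall u v, B u -> B v -> (u == v) || e u v) ->
  (forall S : k.-tuple T, exists u v, [/\ u != v, B u, B v
    & answer e S u = answer e S v]) ->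
  robber_evades_within e k B.
Proof.
move=> clq twin.
have /choice[f hf] : forall S : k.-tuple T, exists uv : T * T,
    [/\ uv.1 != uv.2, B uv.1, B uv.2 & answer e S uv.1 = answer e S uv.2].
  by move=> S; have [u [v ?]] := twin S; exists (u, v).
(* The default of [last] is never reached in a play, since the argument ends with the sensors of the
   current round. *)
pose rho : robber_strategy T k := fun h => (f (last [tuple of nseq k x0] h)).1.
exists rho => c t.
have inB t' v : v \in unzip2 (play e c rho t') -> B v.
  elim: t' v => [//|t' IH] v /=.
  rewrite /unzip2 map_rcons mem_rcons inE => /orP[/eqP ->|]; last exact: IH.
  by rewrite /= /rho last_rcons; case: (hf (c (cop_info e (play e c rho t')))).
split; [exact: clique_robber_walk (@inB _)|exact: inB|].
rewrite /=; set h := play e c rho t; set S := c _.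
rewrite {1}/rho last_rcons => -[v0 hv0].
have [neq Bu Bv eqa] := hf S.
(* Either twin may end the walk: the earlier rounds are kept and the last answer is the same. *)
have comp v : B v -> answer e S v = answer e S (f S).1 ->
    compatible e (rcons h (S, (f S).1)) (rcons (unzip2 h) v).
  move=> Bv' ea; split.
  - by rewrite !size_rcons size_map.
  - apply: clique_robber_walk clq _ => u.
    by rewrite mem_rcons inE => /orP[/eqP ->//|]; exact: inB.
  - rewrite /unzip1 map_rcons /=.
    have -> : zip (rcons (unzip1 h) S) (rcons (unzip2 h) v) = rcons h (S, v).
      elim: (h) => [//|[a b] h' IH] /=.
      by congr (_ :: _).
    by rewrite /cop_info !map_rcons /= ea.
have e1 := hv0 _ _ (comp _ Bu erefl).
have e2 := hv0 _ _ (comp _ Bv (esym eqa)).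
by move: neq; rewrite e1 e2 eqxx.
Qed.

End Game.

(** * Graph distances from a sensor to a clique *)

Section GraphDist.
Variables (T : finType) (e : rel T).

Lemma has_walkP (f : rel T) x y m :
  reflect (exists p, [/\ size p = m, path f x p & last x p = y]) (has_walk f x y m).
Proof.
apply: (iffP existsP) => [[p /andP[pp /eqP lp]]|[p [sp pp lp]]].
  by exists p; rewrite size_tuple.
have sp' : size p == m by apply/eqP.
by exists (Tuple sp') => /=; rewrite pp lp eqxx.
Qed.

Variant graph_dist_spec x y : option nat -> Type :=
| GraphDistSome m of has_walk e x y m
    & (forall m', has_walk e x y m' -> (m <= m')%N) : graph_dist_spec x y (Some m)
| GraphDistNone of (forall m, ~~ has_walk e x y m) : graph_dist_spec x y None.

Lemma graph_distP x y : graph_dist_spec x y (graph_dist e x y).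
Proof.
rewrite /graph_dist; case: pselect => [xy|nxy].
  by case: ex_minnP => m wm minm; constructor.
by constructor => m; apply/negP => wm; apply: nxy; exists m.
Qed.

Lemma graph_dist_adj x y : x != y -> e x y -> graph_dist e x y = Some 1%N.
Proof.
move=> neq exy; have w1 : has_walk e x y 1.
  by apply/has_walkP; exists [:: y]; rewrite /= exy.
case: graph_distP => [[|[|m]] wm minm|/(_ 1%N)]; last by rewrite w1.
- move/has_walkP: wm => [p [/size0nil -> _ /= exy']].
  by rewrite exy' eqxx in neq.
- by [].
- by have := minm _ w1.
Qed.

(** A shortest walk repeats no vertex. This keeps the number of steps inside a finite type, over
    which a union bound can run. *)
Lemma graph_dist_lt x y m : graph_dist e x y = Some m -> (m < #|T|)%N.
Proof.
case: graph_distP => // m' /has_walkP[p [sp pp lp]] minm [<-].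
case/shortenP: pp lp => p' pp' up' _ lp'.
have: (m' <= size p')%N by apply: minm; apply/has_walkP; exists p'.
move=> le; apply: (leq_ltn_trans le).
by have := max_card (mem (x :: p')); rewrite (card_uniqP up').
Qed.

Definition restrict (out : pred T) : rel T := fun i j => [&& out i, out j & e i j].

(** These are walks of exactly [m] steps, not distances at most [m]. The conjunct [out s] matters
    for the empty walk only. *)
Definition reach (out : pred T) (s : T) (m : nat) (j : T) : bool :=
  out s && has_walk (restrict out) s j m.

Lemma reach_out out s m j : reach out s m j -> out j.
Proof.
case/andP => os /has_walkP[p [_ pp <-]].
elim: p s os pp => [//|y p IH] s os /= /andP[/and3P[_ oy _] pp].
exact: IH.
Qed.

Lemma reach_walk out s m j u : reach out s m j -> e j u -> has_walk e s u m.+1.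
Proof.
case/andP => _ /has_walkP[p [sp pp lp]] eju; apply/has_walkP.
exists (rcons p u); rewrite size_rcons sp last_rcons rcons_path lp eju andbT.
by split=> //; apply: sub_path pp => x y /and3P[].
Qed.

(* Since the clique has diameter one, the vertices of a shortest path to its
   closest points, except the last one, avoid the clique. *)
Lemma clique_separation (C : pred T) (s : T) :
  (forall u v, C u -> C v -> u != v -> e u v) -> ~~ C s ->
  exists m : 'I_#|T|, forall u v, C u -> C v ->
    graph_dist e s u != graph_dist e s v ->
    let out := [pred j | ~~ C j] in
    let near w := [exists j, reach out s m j && e j w] in
    near u != near v.
Proof.
move=> clq nCs.
(* Either [m] is the distance from [s] to the clique, attained at [w0], or the clique is unreachable
   and all answers are [None]. *)
have [[m [w0 [Cw0 dw0]] minm]|none] : 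
    (exists2 m, exists w, C w /\ graph_dist e s w = Some m
      & forall w m', C w -> graph_dist e s w = Some m' -> (m <= m')%N) \/
    (forall w, C w -> graph_dist e s w = None); last 1 first.
- have s0 : (0 < #|T|)%N by apply/card_gt0P; exists s.
  by exists (Ordinal s0) => u v Cu Cv; rewrite !none.
- have [[w [Cw [m dm]]]|no] := pselect (exists w, C w /\ exists m, graph_dist e s w = Some m).
    left; have ex : exists m, [exists w, C w && (graph_dist e s w == Some m)].
      by exists m; apply/existsP; exists w; rewrite Cw dm eqxx.
    case: (ex_minnP ex) => m' /existsP[w' /andP[Cw' /eqP dw']] minm.
    exists m'; first by exists w'.
    by move=> x m'' Cx dx; apply: minm; apply/existsP; exists x; rewrite Cx dx eqxx.
  right=> w Cw; case E: graph_dist => [m|//]; exfalso; apply: no.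
  by exists w; split=> //; exists m.
have m0 : (0 < m)%N.
  rewrite lt0n; apply/eqP => m0; move: dw0; rewrite m0.
  case: graph_distP => // m' /has_walkP[p [sp _ lp]] _ [m'0].
  move: sp; rewrite m'0 => /size0nil p0; move: lp; rewrite p0 /= => sw.
  by rewrite sw Cw0 in nCs.
(* The index is [m.-1] because the last of the [m] steps, into the clique, is made by the edge in
   [near]. *)
have mT : (m.-1 < #|T|)%N by rewrite prednK // ltnW // (graph_dist_lt dw0).
exists (Ordinal mT) => u v Cu Cv; set out := [pred j | ~~ C j] => /=.
have nearE w : C w -> [exists j, reach out s m.-1 j && e j w] = (graph_dist e s w == Some m).
  move=> Cw; apply/existsP/eqP => [[j /andP[rj ejw]]|dw].
    have := reach_walk rj ejw; rewrite prednK // => wm.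
    case: (graph_distP s w) (fun m' => minm _ m' Cw) => [m' _ min'|/(_ m)].
      move=> /(_ _ erefl) le; congr Some; apply/eqP.
      by rewrite eqn_leq le min'.
    by rewrite wm.
  have: has_walk e s w m.
    by move: dw; case: graph_distP => // m' wm _ [<-].
  move/has_walkP => [p [sp pp lp]].
  case/lastP: p sp pp lp => [|p w']; first by move=> /= sp; rewrite -sp in m0.
  rewrite size_rcons last_rcons rcons_path => sp /andP[pp ew] ww; subst w'.
  exists (last s p); rewrite ew andbT /reach /= nCs /=.
  apply/has_walkP; exists p; rewrite -sp /=; split=> //.
  (* A clique vertex at position [i <= m.-1] of the walk would be closer to [s] than the minimum
     [m]. *)
  have avoid i : (i <= size p)%N -> out (nth s (s :: p) i).
    move=> ip; apply/negP => Ci.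
    have wi : has_walk e s (nth s (s :: p) i) i.
      apply/has_walkP; exists (take i p); split.
      - by rewrite size_takel.
      - by move: pp; rewrite -{1}(cat_take_drop i p) cat_path => /andP[].
      - case: i ip {Ci} => [|i] ip /=; first by rewrite take0.
        by rewrite (take_nth s) // last_rcons.
    case: (graph_distP s (nth s (s :: p) i)) (fun m' => minm _ m' Ci) => [m' wm' min'|/(_ i)].
      move=> /(_ _ erefl) le; have := leq_trans le (min' _ wi).
      by rewrite -sp => /leq_trans/(_ ip); rewrite ltnn.
    by rewrite wi.
  apply/(pathP s) => i ip; rewrite /restrict.
  rewrite avoid ?(ltnW ip) // (avoid i.+1) //=.
  by move/(pathP s): pp; apply.
rewrite !nearE // => neq.
(* One more step from [w0] reaches every other clique vertex, so only [m] and [m.+1] occur. *)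
have key w : C w -> graph_dist e s w = Some m \/ graph_dist e s w = Some m.+1.
  move=> Cw; have [->|nw] := eqVneq w w0; first by left.
  have ew : e w0 w by rewrite clq // eq_sym.
  have wm1 : has_walk e s w m.+1.
    have: has_walk e s w0 m by move: dw0; case: graph_distP => // m' wm _ [<-].
    move/has_walkP => [p [sp pp lp]]; apply/has_walkP; exists (rcons p w).
    by rewrite size_rcons sp last_rcons rcons_path pp lp ew.
  case: (graph_distP s w) (fun m' => minm _ m' Cw) => [m' wm' min'|/(_ m.+1)]; last by rewrite wm1.
  move=> /(_ _ erefl); have := min' _ wm1; rewrite leq_eqVlt ltnS => /orP[/eqP ->|le1 le2].
    by right.
  by left; congr Some; apply/eqP; rewrite eqn_leq le1.
have n1 : (m.+1 == m) = false by apply/eqP => h; have := ltnn m; rewrite -{2}h ltnS leqnn.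
have o1 : (Some m.+1 == Some m) = false by exact: n1.
by case: (key u Cu) (key v Cv) neq => -> [] ->; rewrite ?eqxx ?o1.
Qed.

End GraphDist.

(** * Discs and cells *)

Section TorusDist.
Variable R : realType.
Implicit Types (s r rho eps : R) (p q : R * R).

Lemma torus_dist_le s p q (z : int * int) :
  torus_dist s p q <= Num.sqrt ((p.1 - q.1 + z.1%:~R * s) ^+ 2
                                + (p.2 - q.2 + z.2%:~R * s) ^+ 2).
Proof.
apply: ge_inf; last by exists z.
by exists 0 => _ [z' _ <-]; exact: sqrtr_ge0.
Qed.

(** An infimum below [rho] is beaten by a single lattice translate. Strict inequality makes it
    unnecessary to know that the infimum is attained, and reduces discs on the torus to discs in the
    plane. *)
Lemma torus_dist_ltP s p q rho : 0 < rho ->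
  torus_dist s p q < rho <->
  exists z : int * int, (p.1 - q.1 + z.1%:~R * s) ^+ 2
                        + (p.2 - q.2 + z.2%:~R * s) ^+ 2 < rho ^+ 2.
Proof.
move=> rho0; have sq u : 0 <= u -> (Num.sqrt u < rho) = (u < rho ^+ 2).
  by move=> u0; rewrite -ltr_sqr ?nnegrE ?sqrtr_ge0 ?ltW // sqr_sqrtr.
have nn z : 0 <= (p.1 - q.1 + z.1%:~R * s) ^+ 2 + (p.2 - q.2 + z.2%:~R * s) ^+ 2.
  by rewrite addr_ge0 ?sqr_ge0.
split=> [/inf_lt[|_ [z _ <-] h]|[z hz]].
- by eexists; exists (0, 0).
- by exists z; rewrite -sq.
- by apply: le_lt_trans (torus_dist_le s p q z) _; rewrite sq.
Qed.

Lemma torus_dist_le_plane s p q rho : 0 <= rho ->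
  (p.1 - q.1) ^+ 2 + (p.2 - q.2) ^+ 2 <= rho ^+ 2 -> torus_dist s p q <= rho.
Proof.
move=> rho0 h; apply: le_trans (torus_dist_le s p q (0, 0)) _ => /=.
by rewrite !mul0r !addr0 -(ger0_norm rho0) -sqrtr_sqr ler_sqrt // sqr_ge0.
Qed.

(** A lattice translate brings both coordinate differences into [0, s), hence a bound of sqrt 2
    times [s]. The factor 5/3 is what a ball of radius r/3 offers when r is at least 5s. *)
Lemma torus_dist_diam s p q : 0 < s -> torus_dist s p q <= 5 / 3 * s.
Proof.
move=> s0.
have red (u : R) : exists z : int, (u + z%:~R * s) ^+ 2 <= s ^+ 2.
  exists (- Num.floor (u / s)); rewrite mulrNz.
  have /andP[h1 h2] := floor_itv (u / s).
  move: h1 h2; set f := (Num.floor (u / s)) => h1 h2.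
  have {}h1 : f%:~R * s <= u by rewrite -ler_pdivlMr.
  have {}h2 : u < (f%:~R + 1) * s.
    by rewrite -ltr_pdivrMr // -[1]/(1%:~R) -intrD.
  rewrite ler_sqr ?nnegrE; lra.
have [z1 h1] := red (p.1 - q.1); have [z2 h2] := red (p.2 - q.2).
apply: le_trans (torus_dist_le s p q (z1, z2)) _ => /=.
have -> : 5 / 3 * s = Num.sqrt ((5 / 3 * s) ^+ 2).
  by rewrite sqrtr_sqr ger0_norm // mulr_ge0 // ltW.
rewrite ler_sqrt ?sqr_ge0 //; nra.
Qed.

(** The displacement has length at most eps / sqrt 2, which is below 3/4 eps. *)
Lemma plane_perturb (a b w1 w2 rho eps : R) : 0 < rho -> 0 < eps ->
  `|w1| <= eps / 2 -> `|w2| <= eps / 2 -> a ^+ 2 + b ^+ 2 < rho ^+ 2 ->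
  (a + w1) ^+ 2 + (b + w2) ^+ 2 < (rho + 3 / 4 * eps) ^+ 2.
Proof.
move=> rho0 eps0 h1 h2 h.
have ab : `|a| + `|b| <= 3 / 2 * rho.
  have n1 : 0 <= `|a| + `|b| by rewrite addr_ge0.
  have n2 : 0 <= 3 / 2 * rho by lra.
  rewrite -ler_sqr ?nnegrE //.
  have := sqr_ge0 (`|a| - `|b|); have := real_normK (num_real a).
  have := real_normK (num_real b); nra.
have haw : a * w1 <= `|a| * (eps / 2).
  by apply: le_trans (ler_norm _) _; rewrite normrM ler_wpM2l.
have hbw : b * w2 <= `|b| * (eps / 2).
  by apply: le_trans (ler_norm _) _; rewrite normrM ler_wpM2l.
have w1s : w1 ^+ 2 <= (eps / 2) ^+ 2.
  by rewrite -(real_normK (num_real w1)) ler_sqr ?nnegrE ?divr_ge0 // ltW.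
have w2s : w2 ^+ 2 <= (eps / 2) ^+ 2.
  by rewrite -(real_normK (num_real w2)) ler_sqr ?nnegrE ?divr_ge0 // ltW.
have abe : (`|a| + `|b|) * (eps / 2) <= 3 / 2 * rho * (eps / 2).
  by apply: (ler_wpM2r _ ab); lra.
have e2 : 0 < eps ^+ 2 by rewrite exprn_gt0.
have -> : (a + w1) ^+ 2 + (b + w2) ^+ 2 =
  a ^+ 2 + b ^+ 2 + 2 * (a * w1) + 2 * (b * w2) + w1 ^+ 2 + w2 ^+ 2 by ring.
have -> : (rho + 3 / 4 * eps) ^+ 2 = rho ^+ 2 + 3 / 2 * rho * eps + 9 / 16 * eps ^+ 2.
  by field.
lra.
Qed.

(** Moving by [t] along the dominant coordinate lowers the squared distance by t(2X - t). For X at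
    least 0.65 r this is at least 3.3 eps r, enough to pass from the larger radius to the smaller;
    for smaller X both coordinates end up at most 0.65 r in absolute value, well inside the disc. *)
Lemma plane_advance (X Y t r eps : R) : 0 < eps -> 10 * eps <= r ->
  3 * eps <= t -> t <= r / 5 -> `|Y| <= X ->
  X ^+ 2 + Y ^+ 2 < (r + 4 / 5 * eps) ^+ 2 ->
  (X - t) ^+ 2 + Y ^+ 2 < (r - 3 / 4 * eps) ^+ 2.
Proof.
move=> eps0 epsr t3 tr YX h.
have X0 : 0 <= X by apply: le_trans YX.
have YX2 : Y ^+ 2 <= X ^+ 2.
  by rewrite -(real_normK (num_real Y)) ler_sqr ?nnegrE.
have [Xr|Xr] := lerP (65 / 100 * r) X.
  have : t * (13 / 10 * r - t) <= t * (2 * X - t) by rewrite ler_wpM2l; lra.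
  have : 3 * eps * (11 / 10 * r) <= t * (13 / 10 * r - t) by rewrite ler_pM; lra.
  nra.
have : (X - t) ^+ 2 <= (65 / 100 * r) ^+ 2.
  rewrite -(real_normK (num_real (X - t))) ler_sqr ?nnegrE; last lra.
    by rewrite ler_norml; lra.
  by [].
have : X ^+ 2 < (65 / 100 * r) ^+ 2 by rewrite ltr_sqr ?nnegrE; lra.
have : (r - 3 / 4 * (r / 10)) ^+ 2 <= (r - 3 / 4 * eps) ^+ 2.
  rewrite ler_sqr ?nnegrE; lra.
nra.
Qed.

End TorusDist.

(** * The grid and the cells cut by a union of discs *)

Section Grid.
Variables (R : realType) (K : nat).
Notation C := ('I_K * 'I_K)%type.
Implicit Types (s r rho lo eps : R) (q : C).

(** Half-open sides make distinct cells disjoint. *)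
Definition cell lo eps (q : C) : set (R * R) :=
  `[lo + (val q.1)%:R * eps, lo + (val q.1).+1%:R * eps[ `*`
  `[lo + (val q.2)%:R * eps, lo + (val q.2).+1%:R * eps[.

Definition cell_center lo eps (q : C) : R * R :=
  (lo + ((val q.1)%:R + 1 / 2) * eps, lo + ((val q.2)%:R + 1 / 2) * eps).

Lemma cellP lo eps q p : cell lo eps q p ->
  [/\ lo + (val q.1)%:R * eps <= p.1, p.1 < lo + (val q.1).+1%:R * eps,
      lo + (val q.2)%:R * eps <= p.2 & p.2 < lo + (val q.2).+1%:R * eps].
Proof. by move=> [/=]; rewrite !in_itv /= => /andP[? ?] /andP[? ?]. Qed.

Lemma cell_disjoint lo eps q q' p : 0 < eps ->
  cell lo eps q p -> cell lo eps q' p -> q = q'.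
Proof.
move=> eps0 /cellP[h1 h2 h3 h4] /cellP[h1' h2' h3' h4'].
have aux (a b : nat) (x : R) : lo + a%:R * eps <= x -> x < lo + b.+1%:R * eps ->
    (a <= b)%N.
  move=> ha hb; have := le_lt_trans ha hb.
  by rewrite ltrD2l ltr_pM2r // ltr_nat ltnS.
case: q q' h1 h2 h3 h4 h1' h2' h3' h4' => [a b] [a' b'] /= h1 h2 h3 h4 h1' h2' h3' h4'.
congr pair; apply/val_inj/eqP; rewrite eqn_leq.
  by rewrite (aux _ _ _ h1 h2') (aux _ _ _ h1' h2).
by rewrite (aux _ _ _ h3 h4') (aux _ _ _ h3' h4).
Qed.

Lemma cell_offset lo eps q p : cell lo eps q p ->
  `|(cell_center lo eps q).1 - p.1| <= eps / 2 /\
  `|(cell_center lo eps q).2 - p.2| <= eps / 2.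
Proof.
case: q => a b /cellP[/= h1 h2 h3 h4]; rewrite /cell_center /=.
move: h2 h4; rewrite -[a.+1%:R]natr1 -[b.+1%:R]natr1 => h2 h4.
by split; rewrite ler_norml; apply/andP; split; lra.
Qed.

Lemma torus_dist_cell_center s lo eps q p x rho : 0 < eps -> 0 < rho ->
  cell lo eps q p -> torus_dist s x p < rho ->
  torus_dist s x (cell_center lo eps q) < rho + 3 / 4 * eps.
Proof.
move=> eps0 rho0 /cell_offset-[h1 h2] /(torus_dist_ltP _ _ _ rho0)-[z hz].
apply/torus_dist_ltP; first by rewrite addr_gt0 // mulr_gt0.
exists z; have := plane_perturb rho0 eps0 _ _ hz.
move=> /(_ (p.1 - (cell_center lo eps q).1) (p.2 - (cell_center lo eps q).2)).
rewrite (distrC p.1) (distrC p.2) => /(_ h1 h2).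
congr (_ < _); congr (_ ^+ 2 + _ ^+ 2); ring.
Qed.

Lemma torus_dist_cell_point s lo eps q p x rho : 0 < eps -> 0 < rho ->
  cell lo eps q p -> torus_dist s x (cell_center lo eps q) < rho ->
  torus_dist s x p < rho + 3 / 4 * eps.
Proof.
move=> eps0 rho0 /cell_offset-[h1 h2] /(torus_dist_ltP _ _ _ rho0)-[z hz].
apply/torus_dist_ltP; first by rewrite addr_gt0 // mulr_gt0.
exists z; have := plane_perturb rho0 eps0 h1 h2 hz.
congr (_ < _); congr (_ ^+ 2 + _ ^+ 2); ring.
Qed.

(* The predicates near and cont of a disc and a cell are thought of as "the disc
   meets the cell" and "the disc contains the cell". *)
Definition mixed (T C' : finType) (rch : pred T) (near cont : T -> C' -> bool) :
    {set C'} :=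
  [set q | [exists j, rch j && near j q] && ~~ [exists j, rch j && cont j q]].

(** Each row contains at most three consecutive values of [f], so the residue of [f] modulo 3
    together with [g] identifies an element of [S]. *)
Lemma card_short_rows (f g : C -> 'I_K) (S : {set C}) :
  injective (fun q => (f q, g q)) ->
  (forall q q', q \in S -> q' \in S -> g q = g q' -> (f q' < f q + 3)%N) ->
  (#|S| <= 3 * K)%N.
Proof.
move=> inj short.
pose h (q : C) : 'I_3 * 'I_K := (inord (f q %% 3), g q).
have hinj : {in S &, injective h}.
  move=> q q' qS q'S [/(congr1 val)/= e1 e2]; apply: inj; rewrite e2; congr pair.
  move: e1; rewrite !inordK ?ltn_pmod // => e1.
  have := short _ _ qS q'S e2; have := short _ _ q'S qS (esym e2).
  by move=> h1 h2; apply: val_inj => /=; move: h1 h2 e1; lia.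
rewrite -(card_in_imset hinj); apply: leq_trans (max_card _) _.
by rewrite card_prod !card_ord.
Qed.

Section MixedCount.
Variables (T : finType) (rch : pred T) (x : T -> R * R) (s r lo eps : R).
Hypotheses (eps0 : 0 < eps) (epsr : 10 * eps <= r) (Kr : K%:R * eps <= r / 5).
Let near j q := torus_dist s (x j) (cell_center lo eps q) < r + 4 / 5 * eps.
Let cont j q := torus_dist s (x j) (cell_center lo eps q) < r - 3 / 4 * eps.

(* A disc of radius r that meets a cell and whose centre lies, say, to the
   right of it contains all cells three columns further right, so that each row
   has at most three mixed cells for each of the four directions. *)
Lemma card_mixed : (#|mixed rch near cont| <= 12 * K)%N.
Proof.
set M := mixed _ _ _.
(* The offset from the centre of cell [q] to the translate by [z] of the point [j]; [ax] selects the
   second coordinate. *)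
pose v (ax : bool) j q (z : int * int) : R :=
  let c := cell_center lo eps q in
  if ax then (x j).2 - c.2 + z.2%:~R * s else (x j).1 - c.1 + z.1%:~R * s.
(* Mixed cells met by a disc whose offset has dominant coordinate [ax] with sign [sg]; the four
   choices cover all mixed cells. *)
pose S (ax sg : bool) := [set q in M | `[< exists j z, [/\ rch j,
  v false j q z ^+ 2 + v true j q z ^+ 2 < (r + 4 / 5 * eps) ^+ 2 &
  `|v (~~ ax) j q z| <= (-1) ^+ sg * v ax j q z] >]].
have r0 : 0 < r by apply: lt_le_trans epsr; rewrite mulr_gt0.
have rp : 0 < r + 4 / 5 * eps by rewrite addr_gt0 // mulr_gt0.
have rm : 0 < r - 3 / 4 * eps.
  rewrite subr_gt0; apply: lt_le_trans epsr; rewrite ltr_pM2r //; lra.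
have cover : M \subset (S false false :|: S false true) :|: (S true false :|: S true true).
  apply/fintype.subsetP => q qM; have := qM; rewrite inE => /andP[/existsP[j /andP[rj nj]] _].
  have [z hz] := (torus_dist_ltP _ _ _ rp).1 nj.
  have mem ax (sg : bool) : `|v (~~ ax) j q z| <= (-1) ^+ sg * v ax j q z -> q \in S ax sg.
    by move=> h; rewrite inE qM; apply/asboolP; exists j, z.
  rewrite !finset.in_setU.
  have [h|/ltW h] := lerP `|v true j q z| `|v false j q z|.
    have [h0|h0] := lerP 0 (v false j q z).
      by rewrite (mem false false) // expr0 mul1r -[leRHS]ger0_norm.
    by rewrite (mem false true) ?orbT // expr1 mulN1r -ltr0_norm.
  have [h0|h0] := lerP 0 (v true j q z).
    by rewrite (mem true false) ?orbT // expr0 mul1r -[leRHS]ger0_norm.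
  by rewrite (mem true true) ?orbT // expr1 mulN1r -ltr0_norm.
have bound ax sg : (#|S ax sg| <= 3 * K)%N.
  have step j z q' : rch j -> v false j q' z ^+ 2 + v true j q' z ^+ 2
      < (r - 3 / 4 * eps) ^+ 2 -> q' \notin M.
    move=> rj h; rewrite inE negb_and; apply/orP; right; rewrite negbK.
    by apply/existsP; exists j; rewrite rj /=; apply/torus_dist_ltP => //; exists z.
  pose f (q : C) := if ax then q.2 else q.1.
  pose g (q : C) := if ax then q.1 else q.2.
  (* If [q'] lies at least three places beyond [q] towards the disc centre, then [plane_advance]
     puts it inside the disc, so it is not mixed. *)
  have main q q' j z : g q = g q' -> rch j ->
      v false j q z ^+ 2 + v true j q z ^+ 2 < (r + 4 / 5 * eps) ^+ 2 ->
      `|v (~~ ax) j q z| <= (-1) ^+ sg * v ax j q z -> q' \in M ->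
      (if sg then f q' + 3 <= f q else f q + 3 <= f q')%N -> False.
    move=> eg rj h1 h2 q'M far; move: q'M; apply/negP; apply: (step j z) => //.
    have eqY : v (~~ ax) j q' z = v (~~ ax) j q z.
      by move: eg; rewrite /v /g /cell_center; case: (ax) => /= ->.
    pose t : R := (-1) ^+ sg * ((f q')%:R - (f q)%:R) * eps.
    have eqX : (-1) ^+ sg * v ax j q' z = (-1) ^+ sg * v ax j q z - t.
      rewrite /t /v /f /cell_center; case: (ax) => /=; ring.
    have t3 : 3 * eps <= t.
      rewrite /t ler_pM2r //; move: far; case: (sg).
        by rewrite -(ler_nat R) natrD expr1 mulN1r; lra.
      by rewrite -(ler_nat R) natrD expr0 mul1r; lra.
    have tr : t <= r / 5.
      apply: le_trans Kr; rewrite /t ler_pM2r //.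
      have fK q0 : (f q0)%:R <= K%:R :> R by rewrite ler_nat ltnW.
      have f0 q0 : 0 <= (f q0)%:R :> R by rewrite ler0n.
      have := fK q; have := fK q'; have := f0 q; have := f0 q'.
      by case: (sg); rewrite ?expr1 ?mulN1r ?expr0 ?mul1r; lra.
    have sw a : v false j a z ^+ 2 + v true j a z ^+ 2
        = ((-1) ^+ sg * v ax j a z) ^+ 2 + v (~~ ax) j a z ^+ 2.
      by rewrite exprMn sqrr_sign mul1r; case: (ax) => //; rewrite addrC.
    rewrite sw eqX eqY; apply: plane_advance t3 tr h2 _ => //.
    by rewrite -sw.
  apply: (@card_short_rows f g).
    by move=> [a b] [a' b']; rewrite /f /g; case: (ax) => -[-> ->].
  move=> q q' /setIdP[qM /asboolP[j [z [rj h1 h2]]]] /setIdP[q'M /asboolP[j' [z' [rj' h1' h2']]]] eg.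
  rewrite ltnNge; apply/negP => far; case: (boolP sg) => hs.
    by have := main q' q j' z' (esym eg) rj' h1' h2' qM; rewrite hs => /(_ far).
  by have := main q q' j z eg rj h1 h2 q'M; rewrite (negbTE hs) => /(_ far).
apply: leq_trans (subset_leq_card cover) _.
apply: leq_trans (leq_card_setU _ _).1 _.
have h1 := (leq_card_setU (S false false) (S false true)).1.
have h2 := (leq_card_setU (S true false) (S true true)).1.
have := bound false false; have := bound true false.
have := bound false true; have := bound true true; lia.
Qed.

End MixedCount.
End Grid.

(** * Measurability and independence *)

Section MeasurablePredicates.
Variables (d : measure_display) (Omega : measurableType d).
Implicit Types b : Omega -> bool.

Definition mpred (b : Omega -> bool) : Prop := measurable [set w | b w].

Lemma mpred_cst (c : bool) : mpred (fun=> c).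
Proof.
rewrite /mpred; case: c.
  by rewrite (_ : [set _ | _] = setT) //; apply/seteqP; split.
by rewrite (_ : [set _ | _] = set0) //; apply/seteqP; split.
Qed.

Lemma mpredN b : mpred b -> mpred (fun w => ~~ b w).
Proof.
move=> mb; rewrite /mpred (_ : [set _ | _] = ~` [set w | b w]).
  exact: measurableC.
by apply/seteqP; split => w /=; [move/negP|move/negP].
Qed.

Lemma mpredI b b' : mpred b -> mpred b' -> mpred (fun w => b w && b' w).
Proof.
move=> mb mb'; rewrite /mpred (_ : [set _ | _] = [set w | b w] `&` [set w | b' w]).
  exact: measurableI.
by apply/seteqP; split => w /= /andP.
Qed.

Lemma mpred_exists (T : finType) (b : T -> Omega -> bool) :
  (forall t, mpred (b t)) -> mpred (fun w => [exists t, b t w]).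
Proof.
move=> mb; rewrite /mpred (_ : [set _ | _] = \bigcup_(t in setT) [set w | b t w]).
  by apply: fin_bigcup_measurable => // t _; exact: mb.
apply/seteqP; split => w /=; first by move=> /existsP[t bt]; exists t.
by move=> [t _ bt]; apply/existsP; exists t.
Qed.

Lemma mpred_forall (T : finType) (b : T -> Omega -> bool) :
  (forall t, mpred (b t)) -> mpred (fun w => [forall t, b t w]).
Proof.
move=> mb; have := mpredN (mpred_exists (fun t => mpredN (mb t))).
congr measurable; apply: eq_set => w; rewrite negb_exists.
by congr is_true; apply: eq_forallb => t; rewrite negbK.
Qed.

Lemma mpred_eq (b b' : Omega -> bool) : mpred b -> b =1 b' -> mpred b'.
Proof. by move=> mb /funext <-. Qed.

Lemma mpred_eqb b (c : bool) : mpred b -> mpred (fun w => b w == c).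
Proof.
by case: c => mb; [apply: mpred_eq mb _|apply: mpred_eq (mpredN mb) _] => w; case: (b w).
Qed.

Lemma mpred_path (T : finType) (e : Omega -> rel T) (x : T) (p : seq T) :
  (forall i j, mpred (fun w => e w i j)) -> mpred (fun w => path (e w) x p).
Proof.
move=> me; elim: p x => [|y p IH] x /=; first exact: mpred_cst.
exact: mpredI.
Qed.

(** The event is a finite union over truth tables, whatever [Psi] is. Thus even a [Psi] that
    quantifies over all strategies gives a measurable event. *)
Lemma measurable_finite_info (T : finType) (b : T -> Omega -> bool)
    (Psi : (T -> bool) -> Prop) :
  (forall t, mpred (b t)) -> measurable [set w | Psi (fun t => b t w)].
Proof.
move=> mb; rewrite (_ : [set _ | _] = \bigcup_(g in [set g : {ffun T -> bool} | Psi g])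
    [set w | [forall t, b t w == g t]]).
  apply: fin_bigcup_measurable; first exact: finite_finset.
  by move=> g _; apply: mpred_forall => t; apply: mpred_eqb.
apply/seteqP; split => w /=.
  move=> h; exists [ffun t => b t w] => /=; last by apply/forallP => t; rewrite ffunE.
  by congr (Psi _): h; apply/funext => t; rewrite ffunE.
move=> [g /= h /forallP hg]; congr (Psi _): h; apply/funext => t.
by rewrite (eqP (hg t)).
Qed.

End MeasurablePredicates.

Section FiniteUnions.
Variables (R : realType) (d : measure_display) (Omega : measurableType d).
Variable P : probability Omega R.

Definition pr (A : set Omega) : R := fine (P A).

Lemma prE A : measurable A -> P A = (pr A)%:E.
Proof. by move=> mA; rewrite /pr fineK // fin_num_measure. Qed.

Lemma pr_ge0 A : 0 <= pr A.
Proof. exact: fine_ge0 (measure_ge0 _ _). Qed.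

Lemma pr_le A B : measurable A -> measurable B -> A `<=` B -> pr A <= pr B.
Proof.
by move=> mA mB AB; rewrite -lee_fin -!prE //; apply: le_measure; rewrite ?inE.
Qed.

Lemma pr_le1 A : measurable A -> pr A <= 1.
Proof. by move=> mA; rewrite -lee_fin -prE //; exact: probability_le1. Qed.

Lemma prC A : measurable A -> pr (~` A) = 1 - pr A.
Proof.
move=> mA; apply: EFin_inj; rewrite EFinB -!prE //; last exact: measurableC.
exact: probability_setC.
Qed.

Lemma pr_union_bound (I : finType) (Q : pred I) (F : I -> set Omega) A :
  (forall i, Q i -> measurable (F i)) -> measurable A ->
  (forall w, A w -> exists2 i, Q i & F i w) ->
  pr A <= \sum_(i | Q i) pr (F i).
Proof.
move=> mF mA sub.
have key s : measurable (\big[setU/set0]_(i <- s | Q i) F i) /\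
    pr (\big[setU/set0]_(i <- s | Q i) F i) <= \sum_(i <- s | Q i) pr (F i).
  elim: s => [|i s [mU IH]]; first by rewrite !big_nil /pr measure0.
  rewrite !big_cons; case: ifP => // Qi; split; first by apply: measurableU => //; exact: mF.
  rewrite -lee_fin -prE; last by apply: measurableU => //; exact: mF.
  have le2 : (P (F i `|` \big[setU/set0]_(j <- s | Q j) F j) <=
      P (F i) + P (\big[setU/set0]_(j <- s | Q j) F j))%E by apply: measureU2 => //; exact: mF.
  apply: le_trans le2 _; rewrite (prE mU) (prE (mF _ Qi)) -EFinD lee_fin.
  by rewrite lerD2l.
have [mU le] := key (index_enum I).
apply: le_trans (pr_le mA mU _) le => w /sub[i Qi Fi].
by rewrite -bigcup_seq_cond; exists i => //=; rewrite mem_index_enum Qi.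
Qed.

Lemma pr_disjoint_union (I : finType) (F : I -> set Omega) :
  (forall i, measurable (F i)) -> (forall i j w, F i w -> F j w -> i = j) ->
  measurable [set w | exists i, F i w] /\
  pr [set w | exists i, F i w] = \sum_i pr (F i).
Proof.
move=> mF dis.
have key s : uniq s -> measurable (\big[setU/set0]_(i <- s) F i) /\
    pr (\big[setU/set0]_(i <- s) F i) = \sum_(i <- s) pr (F i).
  elim: s => [|i s IH] /=; first by rewrite !big_nil /pr measure0.
  move=> /andP[ins /IH[mU eU]]; rewrite !big_cons; split; first exact: measurableU.
  rewrite -eU; apply: EFin_inj; rewrite EFinD -!prE //; last exact: measurableU.
  rewrite measureU //; apply/seteqP; split => // w [Fi].
  rewrite -bigcup_seq => -[j /= js Fj].
  by rewrite (dis _ _ _ Fi Fj) js in ins.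
have := key _ (index_enum_uniq I).
rewrite -bigcup_seq (_ : \bigcup_(_ in _) _ = [set w | exists i, F i w]) //.
apply/seteqP; split => w /= [i]; first by move=> _ ?; exists i.
by move=> ?; exists i => //=; rewrite mem_index_enum.
Qed.

End FiniteUnions.

(** * Independence of points with disjoint index sets *)

Section Independence.
Variables (R : realType) (d d' : measure_display) (Omega : measurableType d).
Variables (E : measurableType d') (P : probability Omega R) (n : nat).
Variable X : 'I_n -> {mfun Omega >-> E}.
Hypothesis indX : mutually_independent P X.

Definition cylinder (B : 'I_n -> set E) : set Omega := [set w | forall i, B i (X i w)].

Lemma cylinderE B : cylinder B = \bigcap_(i in [set: 'I_n]) (X i @^-1` B i).
Proof. by apply/seteqP; split => w /= h i; [move=> _; exact: h|exact: h]. Qed.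

Lemma measurable_cylinder B : (forall i, measurable (B i)) -> measurable (cylinder B).
Proof.
move=> mB; rewrite cylinderE; apply: fin_bigcap_measurable; first exact: finite_finset.
by move=> i _; rewrite -[_ @^-1` _]setTI; exact: measurable_funP.
Qed.

Lemma measurable_preimage_mfun i (B : set E) : measurable B -> measurable (X i @^-1` B).
Proof. by move=> mB; rewrite -[_ @^-1` _]setTI; exact: measurable_funP. Qed.

Lemma pr_cylinder B : (forall i, measurable (B i)) ->
  pr P (cylinder B) = \prod_i pr P (X i @^-1` B i).
Proof.
move=> mB; apply: EFin_inj; rewrite -prE; last exact: measurable_cylinder.
rewrite cylinderE indX // -prodEFin; apply: eq_bigr => i _.
by rewrite prE //; exact: measurable_preimage_mfun.
Qed.

(** The sigma-algebra generated by these cylinders is the information carried by the points with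
    index outside [J]. *)
Definition free_cylinders (J : {set 'I_n}) : set (set Omega) :=
  [set A | exists B, [/\ forall i, measurable (B i), forall i, i \in J -> B i = setT
                       & A = cylinder B]].

(* By uniqueness of finite measures on the pi-system of cylinders. *)
Lemma indep_split (J : {set 'I_n}) (A : set Omega) (B : 'I_n -> set E) :
  <<s free_cylinders J >> A -> (forall i, measurable (B i)) ->
  pr P (A `&` cylinder (fun i => if i \in J then B i else setT)) =
  pr P A * \prod_(i in J) pr P (X i @^-1` B i).
Proof.
move=> sA mB; set C := cylinder _.
have mC : measurable C by apply: measurable_cylinder => i; case: ifP.
have Gm : free_cylinders J `<=` measurable.
  by move=> _ [B' [mB' _ ->]]; exact: measurable_cylinder.
have mA : measurable A.
  move: A sA; apply: smallest_sub => //; exact: sigma_algebra_measurable.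
have prT i : pr P (X i @^-1` setT) = 1.
  by rewrite preimage_setT /pr probability_setT.
have prC' : pr P C = \prod_(i in J) pr P (X i @^-1` B i).
  rewrite pr_cylinder; last by move=> i; case: ifP.
  rewrite (bigID (mem J)) /= [X in _ * X]big1 ?mulr1.
    by apply: eq_bigr => i ->.
  by move=> i /negbTE ->.
rewrite -prC'.
(* Both sides of the claim are finite measures in [A]; they are compared on the cylinders free of
   [J]. *)
pose m1 := mrestr P mC.
pose m2 := mscale (NngNum (pr_ge0 P C)) P.
have : m1 A = m2 A.
  apply: (g_sigma_algebra_measure_unique (free_cylinders J) Gm (fun=> setT)) => //.
  - move=> _; exists (fun=> setT); split=> //.
    by apply/seteqP; split.
  - by apply/seteqP; split => // w _; exists 0%N.
  - move=> _ _ [B1 [m1B f1 ->]] [B2 [m2B f2 ->]].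
    exists (fun i => B1 i `&` B2 i); split.
    + by move=> i; exact: measurableI.
    + by move=> i iJ; rewrite f1 // f2 // setIT.
    + apply/seteqP; split => w /=; first by move=> [h1 h2] i.
      by move=> h; split => i; case: (h i).
  - move=> _ [B' [mB' f' ->]].
    change (P (cylinder B' `&` C) = (pr P C)%:E * P (cylinder B'))%E.
    have -> : cylinder B' `&` C = cylinder (fun i => if i \in J then B i else B' i).
      apply/seteqP; split => w /=.
        by move=> [h1 h2] i; have := h1 i; have := h2 i; case: ifP.
      move=> h; split => i; have := h i; case: ifP => // iJ.
      by rewrite f'.
    rewrite !prE //; last 2 first.
    + exact: measurable_cylinder.
    + by apply: measurable_cylinder => i; case: ifP.
    rewrite -EFinM prC'; congr EFin.
    have -> : pr P (cylinder B') = \prod_(i | i \notin J) pr P (X i @^-1` B' i).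
      rewrite pr_cylinder // (bigID (mem J)) /= big1 ?mul1r // => i iJ.
      by rewrite f'.
    rewrite pr_cylinder; last by move=> i; case: ifP.
    rewrite (bigID (mem J)) /=; congr (_ * _); first by apply: eq_bigr => i ->.
    by apply: eq_bigr => i /negbTE ->.
  - move=> k; rewrite /m1 /= /mrestr setTI.
    exact: le_lt_trans (probability_le1 P mC) (ltry _).
change ((P (A `&` C) = (pr P C)%:E * P A)%E -> pr P (A `&` C) = pr P A * pr P C).
rewrite !prE //; last exact: measurableI.
by rewrite -EFinM => -[->]; exact: mulrC.
Qed.

Lemma measurable_free (J : {set 'I_n}) i : i \notin J ->
  measurable_fun setT (X i : g_sigma_algebraType (free_cylinders J) -> E).
Proof.
move=> iJ _ B mB; rewrite setTI; apply: sub_sigma_algebra.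
exists (fun j => if j == i then B else setT); split.
- by move=> j; case: ifP.
- by move=> j jJ; case: eqP => // ji; rewrite -ji jJ in iJ.
- apply/seteqP; split => w /=; first by move=> h j; case: eqP => // ->.
  by move=> /(_ i); rewrite eqxx.
Qed.

End Independence.

(** * Mixed cells with two points are rare *)

Definition double_cells (n : nat) (C : finType) (inc : 'I_n -> C -> bool) : {set C} :=
  [set q | [exists u, exists v, [&& u != v, inc u q & inc v q]]].

Section UpperTail.
Variables (R : realType) (d d' : measure_display) (Omega : measurableType d).
Variables (E : measurableType d') (P : probability Omega R) (n : nat).
Variable X : 'I_n -> {mfun Omega >-> E}.
Hypothesis indX : mutually_independent P X.
Variables (C : finType) (q0 : C) (S : C -> set E) (p : R).
Hypothesis mS : forall q, measurable (S q).
Hypothesis disjS : forall q q' x, S q x -> S q' x -> q = q'.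
Hypothesis prS : forall i q, pr P (X i @^-1` S q) = p.
(** [Mix J] stands for the mixed cells computed with the points of [J] deleted. The hypotheses say
    that it depends on the other points only and that deleting points that lie in cells changes
    nothing. *)
Variables (Mix : {set 'I_n} -> Omega -> {set C}) (M a : nat).
Hypothesis mMix : forall (J : {set 'I_n}) (D : {set C}),
  <<s free_cylinders X J >> [set w | Mix J w = D].
Hypothesis Mix_local : forall (J : {set 'I_n}) w,
  (forall i, i \in J -> exists q, S q (X i w)) -> Mix J w = Mix (finset.set0) w.
Hypothesis card_Mix : forall (J : {set 'I_n}) w, (#|Mix J w| <= M)%N.

Let inc w i q := `[< S q (X i w) >].

Lemma mpred_inc i q : mpred (fun w => inc w i q).
Proof.
rewrite /mpred (_ : [set _ | _] = X i @^-1` S q); first exact: measurable_preimage_mfun.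
by apply/seteqP; split => w /= /asboolP.
Qed.

Lemma measurable_Mix J D : measurable [set w | Mix J w = D].
Proof.
have := @mMix J D; apply: smallest_sub; first exact: sigma_algebra_measurable.
by move=> _ [B' [mB' _ ->]]; exact: measurable_cylinder.
Qed.

Lemma measurable_many_mixed :
  measurable [set w | (a <= #|Mix (finset.set0) w :&: double_cells (inc w)|)%N].
Proof.
pose b (x : C + 'I_n * C) w := match x with inl q => q \in Mix (finset.set0) w
   | inr iq => inc w iq.1 iq.2 end.
pose Psi (f : C + 'I_n * C -> bool) :=
  (a <= #|[set q | f (inl q)] :&: double_cells (fun i q => f (inr (i, q)))|)%N.
have := @measurable_finite_info _ _ _ b Psi.
rewrite (_ : [set w | Psi _] = [set w | (a <= #|Mix (finset.set0) w :&: double_cells (inc w)|)%N]).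
  apply=> -[q|[i q]]; last exact: mpred_inc.
  rewrite /mpred /b (_ : [set _ | _] =
    \bigcup_(D in [set D : {set C} | q \in D]) [set w | Mix (finset.set0) w = D]).
    apply: fin_bigcup_measurable; first exact: finite_finset.
    by move=> D _; exact: measurable_Mix.
  apply/seteqP; split => w /=; first by move=> h; exists (Mix (finset.set0) w).
  by move=> [D /= qD ->].
apply: eq_set => w; congr (is_true (a <= #|pred_of_set (_ :&: _)|)%N).
by apply/setP => q; rewrite inE.
Qed.

(* The union bound runs over a set of a mixed cells and over the 2a indices of
   the points in them; the mixed cells are computed without these points. *)
Lemma pr_many_mixed_doubles :
  pr P [set w | (a <= #|Mix (finset.set0) w :&: double_cells (inc w)|)%N] <=
  'C(M, a)%:R * (n%:R * p) ^+ (2 * a).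
Proof.
(* For each of [a] chosen cells, [h] names two points in it, told apart by the boolean. *)
pose H := {ffun 'I_a * bool -> 'I_n}.
pose J (h : H) : {set 'I_n} := h @: {: 'I_a * bool}.
pose t (Q : {set C}) (l : nat) := nth q0 (enum Q) l.
pose B (Q : {set C}) (h : H) (i : 'I_n) : set E :=
  \bigcap_(x in [set x : 'I_a * bool | h x = i]) S (t Q x.1).
have mB Q h i : measurable (B Q h i).
  by apply: fin_bigcap_measurable; first exact: finite_finset.
pose F (x : {set C} * {set C} * H) : set Omega :=
  [set w | Mix (J x.2) w = x.1.1] `&`
  cylinder X (fun i => if i \in J x.2 then B x.1.2 x.2 i else setT).
pose ok (x : {set C} * {set C} * H) :=
  [&& x.1.2 \subset x.1.1, #|x.1.2| == a & injectiveb x.2].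
have prF x : ok x -> pr P (F x) = pr P [set w | Mix (J x.2) w = x.1.1] * p ^+ (2 * a).
  move=> /and3P[_ _ /injectiveP hinj]; rewrite indep_split //; congr (_ * _).
  rewrite big_imset /=; last by move=> ? ? _ _; exact: hinj.
  rewrite (eq_bigr (fun=> p)) => [|y _].
    by rewrite prodr_const card_prod card_ord card_bool mulnC.
  rewrite (_ : B _ _ _ = S (t x.1.2 y.1)) ?prS //.
  apply/seteqP; split => z /=; first by move=> /(_ y); exact.
  by move=> h y' /= /hinj ->.
have mF x : measurable (F x).
  apply: measurableI; first exact: measurable_Mix.
  by apply: measurable_cylinder => i; case: ifP.
apply: (@le_trans _ _ (\sum_(x | ok x) pr P (F x))).
  apply: pr_union_bound => //.
    exact: measurable_many_mixed.
  move=> w /= aw.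
  have : (0 < #|[set Q : {set C} | Q \subset Mix (finset.set0) w :&: double_cells (inc w)
       & #|Q| == a]|)%N by rewrite cards_draws bin_gt0.
  move=> /card_gt0P[Q]; rewrite inE => /andP[Qsub Qa].
  have tQ (l : 'I_a) : t Q l \in Q.
    by rewrite -mem_enum /t mem_nth // -cardE (eqP Qa).
  have tinj (l l' : 'I_a) : t Q l = t Q l' -> l = l'.
    move=> /eqP; rewrite /t nth_uniq ?enum_uniq -?cardE ?(eqP Qa) //.
    by move=> /eqP/val_inj.
  have /choice[f hf] : forall l : 'I_a, exists uv : 'I_n * 'I_n,
      [/\ uv.1 != uv.2, S (t Q l) (X uv.1 w) & S (t Q l) (X uv.2 w)].
    move=> l; have := fintype.subsetP Qsub _ (tQ l); rewrite finset.in_setI => /andP[_].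
    rewrite inE => /existsP[u /existsP[v /and3P[uv /asboolP hu /asboolP hv]]].
    by exists (u, v).
  pose h : H := [ffun x => if x.2 then (f x.1).1 else (f x.1).2].
  have hS (x : 'I_a * bool) : S (t Q x.1) (X (h x) w).
    by rewrite ffunE; case: (hf x.1) => _ h1 h2; case: x.2.
  (* Different cells are disjoint and the two points in one cell have different indices. *)
  have hinj : injective h.
    move=> [l b] [l' b'] e; have e1 := hS (l, b); rewrite e in e1.
    have := disjS e1 (hS (l', b')) => /= /tinj ll; subst l'; congr pair.
    move: e; rewrite !ffunE /=; case: (hf l) => /eqP ne _ _.
    by case: (b) (b') => -[] // e; exfalso; apply: ne.
  have eM : Mix (J h) w = Mix (finset.set0) w.
    by apply: Mix_local => i /imsetP[x _ ->]; exists (t Q x.1).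
  exists (Mix (finset.set0) w, Q, h).
    have hib : injectiveb h by apply/injectiveP.
    rewrite /ok /= Qa hib !andbT.
    by apply: fintype.subset_trans Qsub (finset.subsetIl _ _).
  split=> //= i; case: ifP => // _ x /= <-; exact: hS.
rewrite (eq_bigr _ prF).
(* There are n^(2a) functions [h], and each is to contribute at most 'C(M, a) p^(2a). *)
apply: (@le_trans _ _ (\sum_(h : H) 'C(M, a)%:R * p ^+ (2 * a))); last first.
  rewrite sumr_const card_ffun card_prod card_ord card_bool card_ord.
  rewrite -[leLHS]mulr_natr natrX exprMn (mulnC 2 a) -mulrA.
  by rewrite (mulrC (p ^+ _)).
pose G (h : H) (D Q : {set C}) : R := pr P [set w | Mix (J h) w = D] * p ^+ (2 * a).
(* Non-injective [h] are added back, at the price of nonnegative terms. *)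
have mid : \sum_(i | ok i) pr P [set w | Mix (J i.2) w = i.1.1] * p ^+ (2 * a) <=
    \sum_(h : H) \sum_(D : {set C}) \sum_(Q : {set C} | (Q \subset D) && (#|Q| == a)) G h D Q.
  rewrite [leRHS]pair_big_dep /= [leRHS]pair_big_dep /=.
  rewrite (reindex (fun x : H * {set C} * {set C} => (x.1.2, x.2, x.1.1))) /=; last first.
    exists (fun x : {set C} * {set C} * H => (x.2, x.1.1, x.1.2)) => [[[? ?] ?]|[[? ?] ?]] //.
  rewrite [leRHS](bigID (fun x : H * {set C} * {set C} => injectiveb x.1.1)) /=.
  rewrite [leLHS](eq_bigl (fun x : H * {set C} * {set C} =>
     (x.2 \subset x.1.2) && (#|x.2| == a) && injectiveb x.1.1)); last first.
    by move=> x; rewrite /ok /= andbA.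
  rewrite lerDl; apply: sumr_ge0 => -[[h D] Q] /andP[/andP[_ /eqP Qa] _] /=.
  rewrite mulr_ge0 ?pr_ge0 ?exprn_even_ge0 // oddM //.
apply: (le_trans mid); apply: ler_sum => h _.
have pe : 0 <= p ^+ (2 * a) by rewrite exprn_even_ge0 // oddM.
apply: (@le_trans _ _ (\sum_(D : {set C})
   pr P [set w | Mix (J h) w = D] * ('C(M, a)%:R * p ^+ (2 * a)))).
  apply: ler_sum => D _; rewrite sumr_const.
  have -> : #|[pred Q : {set C} | (Q \subset D) && (#|Q| == a)]| = 'C(#|D|, a).
    by rewrite -cards_draws; apply: eq_card => Q; rewrite !inE.
  (* A set [D] of more than [M] cells is never the value of [Mix], so its probability is zero. *)
  rewrite /G -[leLHS]mulr_natr -mulrA; have [DM|DM] := leqP #|D| M.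
    rewrite ler_wpM2l ?pr_ge0 // (mulrC _ (p ^+ _)) ler_wpM2l // ler_nat.
    exact: leq_bin2l.
  rewrite (_ : [set w | _] = set0) ?/pr ?measure0 ?mul0r //.
  apply/seteqP; split => // w /= e; have := card_Mix (J h) w.
  by rewrite e leqNgt DM.
rewrite -mulr_suml ler_piMl //; first by rewrite mulr_ge0.
have [mU <-] := pr_disjoint_union P (measurable_Mix (J h)) (fun D D' w e e' => etrans (esym e) e').
exact: pr_le1.
Qed.

End UpperTail.

(** * Cells with two points are frequent *)

Section LabelMoments.
Variables (R : realType) (n : nat) (C : finType) (p : R) (H : pred 'I_n).
Hypotheses (p0 : 0 <= p) (pC : #|C|%:R * p <= 1).
Notation L := (option C).
Notation F := {ffun 'I_n -> L}.

(** The law of the cell containing a uniform point; [None] stands for a point outside all cells. *)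
Definition label_law (c : L) : R := if c is Some _ then p else 1 - #|C|%:R * p.

Definition label_weight (f : F) : R := \prod_i label_law (f i).

Let Ex (phi : F -> R) : R := \sum_(f : F) phi f * label_weight f.
Let mean (u : L -> R) : R := \sum_c u c * label_law c.
Let h := #|[pred i | H i]|.
Let h' := #|[pred i | ~~ H i]|.

Lemma label_law_ge0 c : 0 <= label_law c.
Proof. by case: c => //=; rewrite subr_ge0. Qed.

Lemma label_weight_ge0 f : 0 <= label_weight f.
Proof. by apply: prodr_ge0 => i _; exact: label_law_ge0. Qed.

(** Linear combinations of products over a block. Products of hit indicators expand into this form,
    and its expectation is a combination of powers of one-point means. *)
Definition blockwise (l : seq (R * (L -> R))) (Q : pred 'I_n) (f : F) : R :=
  \sum_(x <- l) x.1 * \prod_(i | Q i) x.2 (f i).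

Lemma Ex_prod (u v : L -> R) :
  Ex (fun f => (\prod_(i | H i) u (f i)) * \prod_(i | ~~ H i) v (f i)) =
  mean u ^+ h * mean v ^+ h'.
Proof.
rewrite /Ex (eq_bigr (fun f : F =>
  \prod_i ((if H i then u (f i) else v (f i)) * label_law (f i)))); last first.
  move=> f _; rewrite big_split /=; congr (_ * _).
  rewrite [RHS](bigID H) /=; congr (_ * _).
    by apply: eq_bigr => i ->.
  by apply: eq_bigr => i /negbTE ->.
rewrite -(bigA_distr_bigA (fun i c => (if H i then u c else v c) * label_law c)).
rewrite (bigID H) /=; congr (_ * _).
  rewrite -prodr_const; apply: eq_bigr => i Hi.
  by apply: eq_bigr => c _; rewrite Hi.
rewrite -prodr_const; apply: eq_bigr => i /negbTE Hi.
by apply: eq_bigr => c _; rewrite Hi.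
Qed.

Lemma Ex_blockwise l l' :
  Ex (fun f => blockwise l H f * blockwise l' (fun i => ~~ H i) f) =
  (\sum_(x <- l) x.1 * mean x.2 ^+ h) * (\sum_(x <- l') x.1 * mean x.2 ^+ h').
Proof.
rewrite /Ex big_distrlr /=.
under eq_bigr => f _ do rewrite /blockwise big_distrlr /= mulr_suml.
rewrite exchange_big /=; apply: eq_bigr => x _.
under eq_bigr => f _ do rewrite mulr_suml.
rewrite exchange_big /=; apply: eq_bigr => y _.
rewrite mulrACA -Ex_prod mulr_sumr; apply: eq_bigr => f _.
by rewrite -!mulrA; congr (_ * _); rewrite mulrCA.
Qed.

Let miss (q : C) (c : L) : R := (c != Some q)%:R.

Lemma mean1 : mean (fun=> 1) = 1.
Proof.
rewrite /mean (bigD1 None) //= mul1r (reindex_omap Some id) => [|[]//].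
rewrite (eq_bigl xpredT) => [|q]; last by rewrite eqxx.
rewrite (eq_bigr (fun=> p)) => [|q _]; last by rewrite mul1r.
by rewrite sumr_const -[p *+ _]mulr_natl subrK.
Qed.

Lemma mean_hit (u : L -> R) q : mean (fun c => u c * (c == Some q)%:R) = u (Some q) * p.
Proof.
rewrite /mean (bigD1 (Some q)) //= eqxx mulr1 big1 ?addr0 // => c /negbTE ->.
by rewrite mulr0 mul0r.
Qed.

Lemma mean_miss q : mean (miss q) = 1 - p.
Proof.
rewrite -mean1 -[p in RHS]mul1r -(mean_hit (fun=> 1) q) /mean -sumrB.
by apply: eq_bigr => c _; rewrite -mulrBl /miss; case: eqP => _ /=; ring.
Qed.

Lemma mean_miss2 q q' : q != q' -> mean (fun c => miss q c * miss q' c) = 1 - 2 * p.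
Proof.
move=> qq'.
have -> : 1 - 2 * p = mean (miss q) - mean (fun c => miss q c * (c == Some q')%:R).
  rewrite mean_miss mean_hit /miss (_ : Some q' != Some q) ?mul1r; first by ring.
  by apply: contraNneq qq' => -[->].
rewrite /mean -sumrB; apply: eq_bigr => c _.
by rewrite -mulrBl /miss; case: eqP => _; case: eqP => _ /=; ring.
Qed.

Let hitl (q : C) : seq (R * (L -> R)) := [:: (1, fun=> 1); (-1, miss q)].
Let hit2l (q q' : C) : seq (R * (L -> R)) :=
  [:: (1, fun=> 1); (-1, miss q); (-1, miss q'); (1, fun c => miss q c * miss q' c)].

Definition hit (Q : pred 'I_n) q (f : F) : R := 1 - \prod_(i | Q i) (f i != Some q)%:R.

Lemma hitE Q q f : hit Q q f = blockwise (hitl q) Q f.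
Proof. by rewrite /blockwise !big_cons big_nil /= big1 // /hit /miss; ring. Qed.

Lemma hit2E Q q q' f : hit Q q f * hit Q q' f = blockwise (hit2l q q') Q f.
Proof.
rewrite /blockwise !big_cons big_nil /= big1 // big_split /= /hit /miss; ring.
Qed.

Lemma hitP Q q f : (hit Q q f == 0) || (hit Q q f == 1) && [exists i, Q i && (f i == Some q)].
Proof.
have [/existsP ex|/existsPn no] := boolP [exists i, Q i && (f i == Some q)].
  case: ex => i /andP[Qi /eqP fi]; apply/orP; right; rewrite andbT.
  by rewrite /hit (bigD1 i) //= fi eqxx mul0r subr0.
rewrite andbF orbF /hit big1 ?subrr // => i Qi.
by have := no i; rewrite Qi /= => ->.
Qed.

Definition both (q : C) (f : F) : R := hit H q f * hit (fun i => ~~ H i) q f.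

Let theta := (1 - (1 - p) ^+ h) * (1 - (1 - p) ^+ h').

Lemma Ex_both q : Ex (both q) = theta.
Proof.
rewrite /both; under [Ex _]eq_bigr => f _ do rewrite !hitE.
rewrite -/(Ex _) Ex_blockwise !big_cons !big_nil /= mean1 mean_miss !expr1n /theta.
ring.
Qed.

(** This is the probability that [k] points hit both of two given cells; its sign allows the bounds
    for the two halves to be multiplied. *)
Lemma missing_two_ge0 k : 2 * p <= 1 -> 0 <= 1 - 2 * (1 - p) ^+ k + (1 - 2 * p) ^+ k.
Proof.
move=> p2; elim: k => [|k IH]; first by rewrite !expr0; lra.
have le : (1 - 2 * p) ^+ k <= (1 - p) ^+ k.
  by apply: lerXn2r; rewrite ?nnegrE; have := p0; lra.
rewrite !exprS; move: le IH; set x := (1 - p) ^+ k; set y := (1 - 2 * p) ^+ k => le IH.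
have : 0 <= 2 * p * (x - y) by rewrite !mulr_ge0 // subr_ge0.
lra.
Qed.

(** Negative correlation: 1 - 2p is at most (1 - p)^2, so hitting one cell does not favour hitting
    another. The two halves are independent, and the bound is multiplied over them. *)
Lemma Ex_both2 q q' : q != q' -> 2 * p <= 1 -> Ex (fun f => both q f * both q' f) <= theta ^+ 2.
Proof.
move=> qq' p2.
have -> : Ex (fun f => both q f * both q' f) =
   (1 - 2 * (1 - p) ^+ h + (1 - 2 * p) ^+ h) * (1 - 2 * (1 - p) ^+ h' + (1 - 2 * p) ^+ h').
  rewrite /both; under [LHS]eq_bigr => f _ do rewrite mulrACA !hit2E.
  rewrite -/(Ex _) Ex_blockwise !big_cons !big_nil /= mean1 !mean_miss mean_miss2 // !expr1n.
  ring.
have ge0 k := missing_two_ge0 k p2.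
have le k : 1 - 2 * (1 - p) ^+ k + (1 - 2 * p) ^+ k <= (1 - (1 - p) ^+ k) ^+ 2.
  have : (1 - 2 * p) ^+ k <= ((1 - p) ^+ 2) ^+ k.
    apply: lerXn2r; rewrite ?nnegrE ?sqr_ge0 //; first by lra.
    rewrite (_ : (1 - p) ^+ 2 = 1 - 2 * p + p ^+ 2); last by ring.
    by rewrite lerDl sqr_ge0.
  rewrite exprAC; set x := (1 - p) ^+ k => xz.
  rewrite (_ : (1 - x) ^+ 2 = 1 - 2 * x + x ^+ 2); last by ring.
  by rewrite lerD2l.
by rewrite /theta exprMn; apply: ler_pM.
Qed.

Definition count_both (f : F) : R := \sum_q both q f.

Lemma both_sqr q f : both q f ^+ 2 = both q f.
Proof.
rewrite /both exprMn.
have sq Q : hit Q q f ^+ 2 = hit Q q f.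
  by have := hitP Q q f => /orP[/eqP ->|/andP[/eqP -> _]]; rewrite ?expr1n // expr0n.
by rewrite !sq.
Qed.

Lemma Ex_sum (I : finType) (phi : I -> F -> R) :
  Ex (fun f => \sum_i phi i f) = \sum_i Ex (phi i).
Proof.
by rewrite /Ex exchange_big /=; apply: eq_bigr => f _; rewrite mulr_suml.
Qed.

Lemma Ex_count_both : Ex count_both = #|C|%:R * theta.
Proof.
rewrite /count_both Ex_sum (eq_bigr (fun=> theta)) => [|q _]; last exact: Ex_both.
by rewrite sumr_const -[theta *+ _]mulr_natl.
Qed.

Lemma Ex_count_both2 : 2 * p <= 1 ->
  Ex (fun f => count_both f ^+ 2) <= #|C|%:R * theta + (#|C|%:R * theta) ^+ 2.
Proof.
move=> p2.
have -> : Ex (fun f => count_both f ^+ 2) =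
    \sum_q \sum_q' Ex (fun f => both q f * both q' f).
  transitivity (Ex (fun f => \sum_q \sum_q' both q f * both q' f)).
    by apply: eq_bigr => f _; rewrite /count_both expr2 big_distrlr.
  by rewrite Ex_sum; apply: eq_bigr => q _; rewrite Ex_sum.
apply: (@le_trans _ _ (\sum_(q : C) (theta + \sum_(q' : C) theta ^+ 2))).
  apply: ler_sum => q _; rewrite (bigD1 q) //=; apply: lerD.
    rewrite -(Ex_both q) le_eqVlt; apply/orP; left; apply/eqP.
    by apply: eq_bigr => f _; rewrite -expr2 both_sqr.
  rewrite [leRHS](bigD1 q) //=; apply: ler_wpDl; first exact: sqr_ge0.
  by apply: ler_sum => q' q'q; apply: Ex_both2 => //; rewrite eq_sym.
rewrite big_split /= !sumr_const [(#|C|%:R * theta) ^+ 2]exprMn -natrX !mulr_natl -mulrnA.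
by rewrite mulnn.
Qed.

Lemma sum_weight1 : \sum_f label_weight f = 1.
Proof.
have := Ex_prod (fun=> 1) (fun=> 1); rewrite mean1 !expr1n mulr1 => <-.
by apply: eq_bigr => f _; rewrite !big1 ?mul1r.
Qed.

(** Chebyshev's inequality: by negative correlation the variance is at most the mean, because the
    indicators equal their squares. *)
Lemma count_both_lower_tail : 2 * p <= 1 -> 0 < #|C|%:R * theta ->
  \sum_(f : F | count_both f <= #|C|%:R * theta / 2) label_weight f
    <= 4 / (#|C|%:R * theta).
Proof.
move=> p2; set mu := #|C|%:R * theta => mu0.
have var : Ex (fun f => (count_both f - mu) ^+ 2) <= mu.
  have -> : Ex (fun f => (count_both f - mu) ^+ 2) =
      Ex (fun f => count_both f ^+ 2) - 2 * mu * Ex count_both + mu ^+ 2.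
    have e : mu ^+ 2 = \sum_f mu ^+ 2 * label_weight f.
      by rewrite -mulr_sumr sum_weight1 mulr1.
    rewrite [mu ^+ 2 in RHS]e /Ex !mulr_sumr -sumrB -big_split /=.
    by apply: eq_bigr => f _; ring.
  rewrite Ex_count_both -/mu; have := Ex_count_both2 p2; rewrite -/mu; lra.
have c0 : 0 <= 4 / mu ^+ 2 by rewrite divr_ge0 // sqr_ge0.
apply: (@le_trans _ _ (4 / mu ^+ 2 * Ex (fun f => (count_both f - mu) ^+ 2))); last first.
  apply: le_trans (ler_wpM2l c0 var) _.
  rewrite le_eqVlt; apply/orP; left; apply/eqP; field.
  by rewrite gt_eqF.
rewrite mulr_sumr [leRHS](bigID (fun f => count_both f <= mu / 2)) /=.
apply: ler_wpDr.
  apply: sumr_ge0 => f _; apply: mulr_ge0 => //.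
  by apply: mulr_ge0; [exact: sqr_ge0|exact: label_weight_ge0].
apply: ler_sum => f hf; rewrite mulrA ler_peMl ?label_weight_ge0 //.
rewrite mulrAC ler_pdivlMr ?exprn_gt0 // mul1r.
rewrite (_ : 4 * _ = (2 * (mu - count_both f)) ^+ 2); last by ring.
by rewrite ler_sqr ?nnegrE //; lra.
Qed.

End LabelMoments.

Section LowerTail.
Variables (R : realType) (d d' : measure_display) (Omega : measurableType d).
Variables (E : measurableType d') (P : probability Omega R) (n : nat).
Variable X : 'I_n -> {mfun Omega >-> E}.
Hypothesis indX : mutually_independent P X.
Variables (C : finType) (S : C -> set E) (p : R).
Hypothesis mS : forall q, measurable (S q).
Hypothesis disjS : forall q q' x, S q x -> S q' x -> q = q'.
Hypothesis prS : forall i q, pr P (X i @^-1` S q) = p.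
Hypotheses (p0 : 0 <= p) (pC : #|C|%:R * p <= 1) (p2 : 2 * p <= 1).
Variable H : pred 'I_n.

Let inc w i q := `[< S q (X i w) >].

Let lab (c : option C) : set E :=
  if c is Some q then S q else ~` \bigcup_(q in [set: C]) S q.

Lemma measurable_double_cells (Psi : {set C} -> Prop) :
  measurable [set w | Psi (double_cells (inc w))].
Proof.
pose b (x : 'I_n * C) w := inc w x.1 x.2.
have := @measurable_finite_info _ Omega _ b
  (fun f => Psi (double_cells (fun i q => f (i, q)))).
by apply=> -[i q]; exact: (mpred_inc X mS i q).
Qed.

Lemma pr_few_doubles :
  let mu := #|C|%:R * ((1 - (1 - p) ^+ #|[pred i | H i]|) *
                       (1 - (1 - p) ^+ #|[pred i | ~~ H i]|)) in
  0 < mu ->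
  pr P [set w | #|double_cells (inc w)|%:R <= mu / 2] <= 4 / mu.
Proof.
move=> mu mu0.
have mlab c : measurable (lab c).
  case: c => [q|] /=; first exact: mS.
  by apply: measurableC; apply: fin_bigcup_measurable; first exact: finite_finset.
have prlab i c : pr P (X i @^-1` lab c) = label_law p c.
  case: c => [q|] /=; first exact: prS.
  have mF q : measurable (X i @^-1` S q) by exact: measurable_preimage_mfun.
  have [mU eU] := pr_disjoint_union P mF (fun q q' w => @disjS q q' (X i w)).
  have -> : X i @^-1` lab None = ~` [set w | exists q, (X i @^-1` S q) w].
    apply/seteqP; split => w /= h [q] => [hq|_ hq]; apply: h; exists q => //.
  rewrite prC // eU (eq_bigr (fun=> p)) => [|q _]; last exact: prS.
  by rewrite sumr_const -[p *+ _]mulr_natl.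
apply: le_trans (count_both_lower_tail p0 pC p2 mu0).
rewrite (eq_bigr (fun f : {ffun 'I_n -> option C} =>
   pr P (cylinder X (fun i => lab (f i))))) => [|f _]; last first.
  by rewrite pr_cylinder //; apply: eq_bigr => i _; rewrite prlab.
apply: pr_union_bound.
- by move=> f _; exact: measurable_cylinder.
- exact: (measurable_double_cells (fun D => #|D|%:R <= mu / 2)).
(* The labelling realised by the outcome [w]; its cylinder contains [w], and its count is at most
   the number of double cells. *)
move=> w /= few; pose f : {ffun 'I_n -> option C} := [ffun i => [pick q | inc w i q]].
have fP i q : f i = Some q -> inc w i q.
  by rewrite ffunE; case: pickP => // q' h [<-].
exists f; last first.
  move=> i; case Ef : (f i) => [q|] /=; first exact/asboolP/fP.
  move=> [q _ Sq]; move: Ef; rewrite ffunE; case: pickP => // /(_ q).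
  by rewrite /inc (asboolT Sq).
apply: le_trans few.
rewrite -sum1_card natr_sum [leRHS]big_mkcond /=; apply: ler_sum => q _.
rewrite /both.
have := hitP R H q f => /orP[/eqP ->|/andP[/eqP -> /existsP[i /andP[Hi /eqP fi]]]].
  by rewrite mul0r; case: ifP.
have := hitP R (fun i => ~~ H i) q f => /orP[/eqP ->|/andP[/eqP -> /existsP[j /andP[Hj /eqP fj]]]].
  by rewrite mulr0; case: ifP.
rewrite mulr1 ifT // inE; apply/existsP; exists i; apply/existsP; exists j.
rewrite !fP // !andbT; apply: contraNneq Hj => <-; exact: Hi.
Qed.

End LowerTail.

(** * Evasion in the grid *)

Section GridEvasion.
Variables (R : realType) (n K k a : nat) (x : 'I_n -> R * R) (r lo eps : R).
Notation C := ('I_K * 'I_K)%type.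
Let s : R := torus_side R n.
Let e := torus_graph r x.
Let inc i (q : C) := `[< cell lo eps q (x i) >].
Let inB i := [exists q, inc i q].
Let out := [pred i | ~~ inB i].
Let near j (q : C) := torus_dist s (x j) (cell_center lo eps q) < r + 4 / 5 * eps.
Let cont j (q : C) := torus_dist s (x j) (cell_center lo eps q) < r - 3 / 4 * eps.
Hypotheses (eps0 : 0 < eps) (epsr : 10 * eps <= r) (Kr : K%:R * eps = r / 5).
Hypothesis centered : lo + K%:R * eps / 2 = s / 2.
Hypothesis few_mixed : forall (i m : 'I_n),
  (#|mixed (reach e out i m) near cont :&: double_cells inc| <= a)%N.
Hypothesis a0 : (0 < a)%N.
Hypothesis many_double : (k * a < #|double_cells inc|)%N.

Let r0 : 0 < r. Proof. by apply: lt_le_trans epsr; rewrite mulr_gt0. Qed.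

Lemma inB_coord i : inB i ->
  [/\ `|(x i).1 - s / 2| <= r / 10 & `|(x i).2 - s / 2| <= r / 10].
Proof.
move=> /existsP[[u v] /asboolP/cellP[/= h1 h2 h3 h4]].
have bd (b : 'I_K) : 0 <= b%:R * eps /\ b.+1%:R * eps <= K%:R * eps.
  by split; [rewrite mulr_ge0 // ltW|rewrite ler_pM2r // ler_nat].
have [u0 uK] := bd u; have [v0 vK] := bd v.
have := centered; have := Kr.
by split; rewrite ler_norml; apply/andP; split; lra.
Qed.

Lemma inB_ball i : inB i -> torus_ball n (torus_center R n) (r / 3) (x i).
Proof.
move=> /inB_coord[h1 h2]; apply: torus_dist_le_plane; first by rewrite divr_ge0 // ltW.
rewrite /torus_center /= -/s; move: h1 h2; rewrite !ler_norml => /andP[? ?] /andP[? ?].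
have : (s / 2 - (x i).1) ^+ 2 <= (r / 10) ^+ 2 by nra.
have : (s / 2 - (x i).2) ^+ 2 <= (r / 10) ^+ 2 by nra.
have := sqr_ge0 r; rewrite !expr_div_n; lra.
Qed.

Lemma inB_clique i j : inB i -> inB j -> i != j -> e i j.
Proof.
move=> /inB_coord[h1 h2] /inB_coord[h3 h4] ij; rewrite /e /torus_graph ij /=.
apply: torus_dist_le_plane; first exact: ltW.
move: h1 h2 h3 h4; rewrite !ler_norml => /andP[? ?] /andP[? ?] /andP[? ?] /andP[? ?].
have : ((x i).1 - (x j).1) ^+ 2 <= (r / 5) ^+ 2 by nra.
have : ((x i).2 - (x j).2) ^+ 2 <= (r / 5) ^+ 2 by nra.
have := sqr_ge0 r; rewrite !expr_div_n; lra.
Qed.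

(** Suppose two vertices of one cell get different answers from a sensor outside the square. Then
    one is covered by a disc around a reached vertex, so a disc meets the cell, and the other is
    not, so no disc contains the cell: the cell is mixed. *)
Lemma unseparated_cell (t : 'I_n) : exists D : {set C}, (#|D| <= a)%N /\
  forall q u v, q \in double_cells inc -> q \notin D -> inc u q -> inc v q ->
  graph_dist e t u = graph_dist e t v.
Proof.
have incB u q : inc u q -> inB u by move=> h; apply/existsP; exists q.
have [tB|tB] := boolP (inB t).
  (* A sensor in the square is at distance 1 from all other vertices there, so it spoils its own
     cell only; [0 < a] leaves room for it. *)
  exists (finset.finset (inc t)); split.
    apply: leq_trans a0; apply/card_le1P => q; rewrite inE => /asboolP tq q'.
    rewrite !inE; apply/idP/eqP => [/asboolP tq'|->]; last exact/asboolP.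
    exact: cell_disjoint eps0 tq' tq.
  move=> q u v _; rewrite inE => tq uq vq.
  have ne w : inc w q -> t != w by move=> wq; apply: contraNneq tq => ->.
  rewrite !graph_dist_adj //; try exact: ne; apply: inB_clique => //; try exact: ne.
    exact: incB vq.
  exact: incB uq.
have [m sep] := clique_separation (fun u v hu hv => @inB_clique u v hu hv) tB.
have mn : (m < n)%N by move: (ltn_ord m); move: (nat_of_ord m) => m'; rewrite card_ord.
exists (mixed (reach e out t (Ordinal mn)) near cont :&: double_cells inc).
split; first exact: few_mixed.
move=> q u v qd qnot uq vq; apply/eqP; apply: contraNT qnot => ne.
rewrite finset.in_setI qd andbT.
pose near1 w := [exists j, reach e out t m j && e j w].
have nn : near1 u != near1 v := sep u v (incB _ _ uq) (incB _ _ vq) ne.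
wlog : u v uq vq nn {ne} / near1 u && ~~ near1 v.
  move=> W; case: (boolP (near1 u)) => h1.
    by apply: (W u v) => //; rewrite h1 /=; apply: contra nn => ->; rewrite h1.
  apply: (W v u) => //; first by rewrite eq_sym.
  by rewrite h1 andbT; move: nn; rewrite (negbTE h1); case: (near1 v).
move=> /andP[/existsP[j /andP[rj eju]] /existsPn nv].
rewrite inE; apply/andP; split.
  apply/existsP; exists j; rewrite rj /=.
  move: eju => /andP[_ dju]; rewrite /near.
  (* Adjacency is non-strict. The slack eps/20 makes it strict and, with the 3/4 eps to the cell
     centre, gives the 4/5 eps in [near]. *)
  have : torus_dist s (x j) (x u) < r + eps / 20.
    by apply: le_lt_trans dju _; rewrite ltrDl divr_gt0.
  move=> /(torus_dist_cell_center eps0 _ (asboolW uq)) => /(_ (addr_gt0 r0 (divr_gt0 eps0 _))).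
  move=> /(_ (ltr0n _ _)) /lt_le_trans; apply; lra.
apply/existsPn => j'; apply/negP => /andP[rj' cj'].
have := nv j'; rewrite rj' /=; apply/negP; rewrite negbK /e /torus_graph.
apply/andP; split.
  (* Adjacency needs distinct vertices: [j'] is outside the square and [v] inside. *)
  apply: contraTneq (reach_out rj') => ->.
  by rewrite /out /= negbK; exact: incB vq.
have rm : 0 < r - 3 / 4 * eps by have := eps0; have := epsr; lra.
have := torus_dist_cell_point eps0 rm (asboolW vq) cj'.
by rewrite subrK => /ltW.
Qed.

Lemma grid_evades : robber_evades_within e k
  [set i | torus_ball n (torus_center R n) (r / 3) (x i)].
Proof.
have /card_gt0P[qq] : (0 < #|double_cells inc|)%N by exact: leq_ltn_trans many_double.
rewrite inE => /existsP[x0 _].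
have [rho hrho] : robber_evades_within e k [set i | inB i].
  apply: (clique_evades x0) => [u v Bu Bv|S].
    by have [//|ne /=] := eqVneq u v; exact: inB_clique.
  have /choice[D hD] := unseparated_cell.
  have cardU (l : seq 'I_n) : (#|\bigcup_(t <- l) D t| <= size l * a)%N.
    elim: l => [|t l IH]; first by rewrite big_nil cards0.
    rewrite big_cons; apply: leq_trans (leq_card_setU _ _).1 _.
    by rewrite /= mulSn leq_add // (hD t).1.
  (* The [k] sensors spoil at most [k * a] cells, fewer than there are double cells. *)
  have /subsetPn[q qd qn] : ~~ (double_cells inc \subset \bigcup_(t <- S) D t).
    apply/negP => /subset_leq_card le; have := leq_trans many_double (leq_trans le (cardU S)).
    by rewrite size_tuple ltnn.
  have := qd; rewrite inE => /existsP[u /existsP[v /and3P[uv uq vq]]].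
  exists u, v; split=> //; try by apply/existsP; exists q.
  apply: val_inj; rewrite /=; apply/eq_in_map => t tS; rewrite /=.
  apply: (hD t).2 qd _ uq vq; apply: contra qn => qt.
  by rewrite (big_rem t) //= finset.in_setU qt.
exists rho => c t; have [h1 h2 h3] := hrho c t; split=> // v /h2; exact: inB_ball.
Qed.

End GridEvasion.

(** * Events on the torus *)

Section TorusMeasurable.
Variables (R : realType) (d : measure_display) (Omega : measurableType d).
Implicit Types (f g : Omega -> R * R) (s rho : R).

Lemma mpred_torus_dist_lt f g s rho : measurable_fun setT f -> measurable_fun setT g ->
  mpred (fun w => torus_dist s (f w) (g w) < rho).
Proof.
move=> mf mg; have [rho0|rho0] := ltP 0 rho; last first.
  apply: mpred_eq (mpred_cst _ false) _ => w; apply/esym/negbTE; rewrite -leNgt.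
  apply: le_trans rho0 _; apply: lb_le_inf; first by eexists; exists (0, 0).
  by move=> _ [z _ <-]; exact: sqrtr_ge0.
rewrite /mpred (_ : [set _ | _] = \bigcup_(z : int * int) [set w |
   ((f w).1 - (g w).1 + z.1%:~R * s) ^+ 2 + ((f w).2 - (g w).2 + z.2%:~R * s) ^+ 2 < rho ^+ 2]).
  apply: countable_bigcupT_measurable => //= z.
  have mc (h : R * R -> R) (c : R) : measurable_fun setT h ->
      measurable_fun setT (fun w => (h (f w) - h (g w) + c) ^+ 2).
    move=> mh; apply: measurable_funX; apply: measurable_funD => //.
    by apply: measurable_funB; apply: measurableT_comp.
  rewrite -[X in measurable X]setTI.
  have := @measurable_fun_ltr _ Omega R setT _ _
     (measurable_funD (mc fst (z.1%:~R * s) measurable_fst) (mc snd (z.2%:~R * s) measurable_snd))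
     (measurable_cst (rho ^+ 2)).
  by move=> /(_ measurableT [set true]) h; apply: h.
apply/seteqP; split => w /=.
  by move=> /torus_dist_ltP-/(_ rho0)[z hz]; exists z.
by move=> [z _ hz]; apply/torus_dist_ltP => //; exists z.
Qed.

Lemma mpred_torus_dist_le f g s rho : measurable_fun setT f -> measurable_fun setT g ->
  mpred (fun w => torus_dist s (f w) (g w) <= rho).
Proof.
move=> mf mg; rewrite /mpred (_ : [set _ | _] =
   \bigcap_(m : nat) [set w | torus_dist s (f w) (g w) < rho + m.+1%:R^-1]).
  by apply: bigcapT_measurable => m; exact: mpred_torus_dist_lt.
apply/seteqP; split => w /=.
  by move=> h m _ /=; apply: le_lt_trans h _; rewrite ltrDl invr_gt0.
move=> h; rewrite leNgt; apply/negP => lt.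
have [m hm] := ltr_add_invr lt.
by have := lt_trans hm (h m I); rewrite ltxx.
Qed.

End TorusMeasurable.

Section CompleteTorus.
Variables (R : realType) (n k : nat) (x : 'I_n -> R * R) (r : R).
Hypotheses (rs : 5 * torus_side R n <= r) (kn : (k.+1 < n)%N).

(** The graph is complete, so two vertices that carry no sensor get answer 1 from all sensors;
    [k.+1 < n] provides them. *)
Lemma complete_evades : robber_evades_within (torus_graph r x) k
  [set i | torus_ball n (torus_center R n) (r / 3) (x i)].
Proof.
have n0 : (0 < n)%N by apply: leq_trans kn.
have s0 : 0 < torus_side R n by rewrite sqrtr_gt0 ltr0n.
have adj i j : i != j -> torus_graph r x i j.
  move=> ij; rewrite /torus_graph ij /=.
  by apply: le_trans (torus_dist_diam _ _ s0) _; move: rs; lra.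
apply: (clique_evades (Ordinal n0)) => [u v _ _|S].
  by have [//|ne /=] := eqVneq u v; exact: adj.
have ball i : torus_ball n (torus_center R n) (r / 3) (x i).
  by apply: le_trans (torus_dist_diam _ _ s0) _; move: rs; lra.
have : (1 < #|~: [set i in (S : seq 'I_n)]%SET|)%N.
  rewrite -(leq_add2l #|[set i in (S : seq 'I_n)]%SET|) cardsC card_ord.
  apply: leq_trans kn; rewrite -[k.+2]addn2 leq_add2r cardsE.
  by apply: leq_trans (card_size _) _; rewrite size_tuple.
move=> /card_gt1P[u [v [uS vS uv]]]; exists u, v; split=> //; try exact: ball.
apply: val_inj; rewrite /=; apply/eq_in_map => t tS /=.
have ne w : w \in ~: [set i in (S : seq 'I_n)]%SET -> t != w.
  by rewrite !inE; apply: contraNneq => <-.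
by rewrite !graph_dist_adj ?adj ?ne.
Qed.

End CompleteTorus.

Section MixedMeasurable.
Variables (R : realType) (d : measure_display) (Omega : measurableType d).
Variables (n K : nat) (X : 'I_n -> {mfun Omega >-> (R * R)%type}).
Variables (r lo eps : R) (i0 : 'I_n) (m : nat).
Notation C := ('I_K * 'I_K)%type.
Let s : R := torus_side R n.

Definition in_cell w i (q : C) := `[< cell lo eps q (X i w) >].

(** Deleting [J] at this place makes every later construction independent of the positions of the
    points in [J]. *)
Definition outside (J : {set 'I_n}) w : pred 'I_n :=
  [pred i | (i \notin J) && ~~ [exists q, in_cell w i q]].

Lemma outsideE J w i :
  outside J w i = (i \notin J) && ~~ [exists q, in_cell w i q].
Proof. by []. Qed.

Definition mixed_cells (J : {set 'I_n}) (w : Omega) : {set C} :=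
  mixed (reach (torus_graph r (fun i => X i w)) (outside J w) i0 m)
    (fun j q => torus_dist s (X j w) (cell_center lo eps q) < r + 4 / 5 * eps)
    (fun j q => torus_dist s (X j w) (cell_center lo eps q) < r - 3 / 4 * eps).

Lemma measurable_cell q : measurable (@cell R K lo eps q).
Proof. exact: measurableX. Qed.

Lemma sigma_mixed_cells (J : {set 'I_n}) (D : {set C}) :
  <<s free_cylinders X J >> [set w | mixed_cells J w = D].
Proof.
(* [Omega] with the smaller sigma-algebra is itself a measurable space, so the [mpred] lemmas apply
   there. Conditions on reached vertices in [J] are constantly false. *)
pose O := g_sigma_algebraType (free_cylinders X J).
have mX i : i \notin J -> measurable_fun setT (X i : O -> R * R).
  exact: measurable_free.
have mout i : @mpred _ O (fun w => outside J w i).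
  have [iJ|iJ] := boolP (i \in J).
    by apply: mpred_eq (mpred_cst _ false) _ => w; rewrite outsideE iJ.
  apply: (@mpred_eq _ O (fun w => ~~ [exists q, in_cell w i q])); last first.
    by move=> w; rewrite outsideE iJ.
  apply: mpredN; apply: mpred_exists => q; rewrite /mpred.
  rewrite (_ : [set _ | _] = setT `&` (X i : O -> R * R) @^-1` cell lo eps q).
    by apply: mX => //; exact: measurable_cell.
  by rewrite setTI; apply/seteqP; split => w /= /asboolP.
have mreach j : @mpred _ O (fun w => reach (torus_graph r (fun i => X i w)) (outside J w) i0 m j).
  apply: mpredI => //; apply: mpred_exists => t; apply: mpredI; last exact: mpred_cst.
  apply: mpred_path => i k; rewrite /restrict.
  have [iJ|iJ] := boolP (i \in J).
    apply: mpred_eq (mpred_cst _ false) _ => w; apply/esym/negbTE/negP.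
    by case/andP; rewrite outsideE iJ.
  have [kJ|kJ] := boolP (k \in J).
    apply: mpred_eq (mpred_cst _ false) _ => w; apply/esym/negbTE/negP.
    by case/and3P => _; rewrite outsideE kJ.
  apply: mpredI => //; apply: mpredI => //; apply: mpredI; first exact: mpred_cst.
  by apply: mpred_torus_dist_le; exact: mX.
have mdist j q (rho : R) : @mpred _ O (fun w =>
    reach (torus_graph r (fun i => X i w)) (outside J w) i0 m j &&
    (torus_dist s (X j w) (cell_center lo eps q) < rho)).
  have [jJ|jJ] := boolP (j \in J).
    apply: mpred_eq (mpred_cst _ false) _ => w; apply/esym/negbTE.
    rewrite negb_and; apply/orP; left; apply/negP => /reach_out.
    by rewrite outsideE jJ.
  apply: mpredI => //; apply: mpred_torus_dist_lt; first exact: mX.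
  exact: measurable_cst.
have : @mpred _ O (fun w => [forall q, (q \in mixed_cells J w) == (q \in D)]).
  apply: mpred_forall => q; apply: mpred_eqb; rewrite /mixed_cells /mixed.
  apply: (@mpred_eq _ O (fun w =>
     [exists j, reach (torus_graph r (fun i => X i w)) (outside J w) i0 m j &&
     (torus_dist s (X j w) (cell_center lo eps q) < r + 4 / 5 * eps)] &&
     ~~ [exists j, reach (torus_graph r (fun i => X i w)) (outside J w) i0 m j &&
     (torus_dist s (X j w) (cell_center lo eps q) < r - 3 / 4 * eps)])); last first.
    by move=> w; rewrite inE.
  by apply: mpredI; [|apply: mpredN]; apply: mpred_exists => j; exact: mdist.
rewrite /mpred /=; congr (<<s _ >> _); apply/seteqP; split => w /=.
  by move=> /forallP h; apply/setP => q; exact/eqP/h.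
by move=> ->; apply/forallP => q.
Qed.

Lemma mixed_cells_local (J : {set 'I_n}) w :
  (forall i, i \in J -> exists q, cell lo eps (q : C) (X i w)) ->
  mixed_cells J w = mixed_cells (finset.set0) w.
Proof.
move=> JB; rewrite /mixed_cells; suff -> : outside J w = outside finset.set0 w by [].
apply/funext => i; rewrite !outsideE finset.in_set0 /=.
have [iJ|//] := boolP (i \in J); apply/esym/negbTE; rewrite negbK.
by have [q hq] := JB _ iJ; apply/existsP; exists q; apply/asboolP.
Qed.

End MixedMeasurable.

Section UniformCell.
Variables (R : realType) (d : measure_display) (Omega : measurableType d).
Variables (P : probability Omega R) (n K : nat).
Variables (Y : {mfun Omega >-> (R * R)%type}) (lo eps : R).
Hypothesis unif : uniform_on P (@torus_square R n) Y.
Hypotheses (n0 : (0 < n)%N) (lo0 : 0 <= lo) (eps0 : 0 < eps).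
Hypothesis hi : lo + K%:R * eps <= torus_side R n.

Lemma pr_uniform_cell (q : 'I_K * 'I_K) :
  pr P (Y @^-1` cell lo eps q) = eps ^+ 2 / n%:R.
Proof.
case: q => u v; have hi' := hi; set s := torus_side R n in hi'.
have s0 : 0 < s by rewrite sqrtr_gt0 ltr0n.
have len (b : nat) : lebesgue_measure `[lo + b%:R * eps, lo + b.+1%:R * eps[%classic = eps%:E.
  rewrite lebesgue_measure_itv /= lte_fin ltrD2l ltr_pM2r // ltr_nat ltnSn -EFinB.
  by congr EFin; rewrite -natr1; ring.
have lenD : lebesgue_measure `[0, s]%classic = s%:E.
  by rewrite lebesgue_measure_itv /= lte_fin s0 oppr0 adde0.
have areaD : area (@torus_square R n) = (n%:R)%:E.
  pose I0 : set R := `[0, s]%classic.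
  transitivity (lebesgue_measure I0 * lebesgue_measure I0)%E.
    exact: product_measure1E.
  by rewrite lenD -EFinM -expr2 sqr_sqrtr // ler0n.
have areaC : area (cell lo eps (u, v) `&` (@torus_square R n)) = (eps ^+ 2)%:E.
  rewrite setIidl.
    pose I0 (b : nat) : set R := `[lo + b%:R * eps, lo + b.+1%:R * eps[%classic.
    transitivity (lebesgue_measure (I0 u) * lebesgue_measure (I0 v))%E.
      exact: product_measure1E.
    by rewrite !len -EFinM expr2.
  move=> z /cellP[/= h1 h2 h3 h4].
  have bd (b : 'I_K) : 0 <= b%:R * eps /\ b.+1%:R * eps <= K%:R * eps.
    by split; [rewrite mulr_ge0 // ltW|rewrite ler_pM2r // ler_nat].
  have [? ?] := bd u; have [? ?] := bd v.
  by split; rewrite /= in_itv /=; apply/andP; split; have := hi; have := lo0; lra.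
rewrite /pr unif; last exact: measurableX.
by rewrite areaC areaD -EFinM.
Qed.

End UniformCell.

(** * Choice of the parameters *)

Section Numeric.
Variable R : realType.
Implicit Types (p z r l : R).

Lemma expR1_le4 : expR 1 <= 4 :> R.
Proof.
have h : 1 / 2 <= expR (- (1 / 2)) :> R by have := @expR_ge1Dx R (- (1 / 2)); lra.
have e2 : expR (- (1 / 2)) ^+ 2 = expR (- 1) :> R.
  by rewrite expr2 -expRD; congr expR; field.
have : (1 / 4 : R) <= expR (- 1) by rewrite -e2; nra.
rewrite expRN -[leLHS]invrK lef_pV2 ?posrE ?expR_gt0 // ?invr_gt0 //; last by lra.
Qed.

(** With t = e z, one term of the binomial expansion gives 'C(M, a) t^a <= (1 + t)^M <= exp(t M). *)
Lemma binomial_tail (M a : nat) z : 0 <= z ->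
  'C(M, a)%:R * z ^+ a <= expR (expR 1 * (z * M%:R) - a%:R).
Proof.
move=> z0; have [aM|Ma] := leqP a M; last first.
  by rewrite bin_small // mul0r expR_ge0.
set t := expR 1 * z; have t0 : 0 <= t by rewrite mulr_ge0 ?expR_ge0.
have h1 : 'C(M, a)%:R * t ^+ a <= (1 + t) ^+ M.
  have aM' : (a < M.+1)%N by [].
  rewrite exprDn (bigD1 (Ordinal aM')) //= expr1n mul1r mulr_natl lerDl.
  by apply: sumr_ge0 => i _; rewrite expr1n mul1r mulrn_wge0 // exprn_ge0.
have h2 : (1 + t) ^+ M <= expR (t * M%:R).
  rewrite expRM_natr; apply: lerXn2r; rewrite ?nnegrE ?expR_ge0 ?addr_ge0 //.
  exact: expR_ge1Dx.
have -> : 'C(M, a)%:R * z ^+ a = 'C(M, a)%:R * t ^+ a * expR (- a%:R).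
  have e : expR a%:R * expR (- a%:R) = 1 :> R by rewrite -expRD subrr expR0.
  by rewrite /t exprMn -expRM_natl mulr1 -mulrA mulrAC e mul1r.
rewrite expRD mulrA ler_wpM2r ?expR_ge0 //; exact: le_trans h2.
Qed.

(** From (1 - p)^h (1 + h p) <= 1 the hit probability is at least hp / (1 + hp). Here hp is at least
    0.49 [e2], and [e2 <= 1 / 4] keeps the quotient above 0.43 [e2]. *)
Lemma hit_probability_ge (h n : nat) (e2 : R) : 0 <= e2 -> e2 <= 1 / 4 ->
  (0 < n)%N -> 49 / 100 * n%:R <= h%:R :> R ->
  43 / 100 * e2 <= 1 - (1 - e2 / n%:R) ^+ h.
Proof.
move=> e0 e4 n0 hn; set p := e2 / n%:R.
have n0' : 0 < n%:R :> R by rewrite ltr0n.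
have p0 : 0 <= p by rewrite divr_ge0 // ler0n.
have p1 : p <= 1.
  rewrite ler_pdivrMr // mul1r; have : (1 : R) <= n%:R by rewrite ler1n.
  lra.
have bern : (1 - p) ^+ h * (1 + h%:R * p) <= 1.
  elim: (h) => [|j IH]; first by rewrite expr0 mul0r addr0 mulr1.
  apply: le_trans IH; rewrite exprSr -mulrA ler_wpM2l ?exprn_ge0 ?subr_ge0 //.
  have -> : (1 - p) * (1 + j.+1%:R * p) = 1 + j%:R * p - j.+1%:R * p ^+ 2.
    by rewrite -natr1; ring.
  by rewrite gerBl mulr_ge0 ?sqr_ge0.
have hp : 49 / 100 * e2 <= h%:R * p.
  rewrite /p mulrA ler_pdivlMr //; nra.
have A0 : 0 <= (1 - p) ^+ h by rewrite exprn_ge0 // subr_ge0.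
move: bern A0; set A := (1 - p) ^+ h => bern A0.
have bern2 : A * (1 + 49 / 100 * e2) <= 1.
  by apply: le_trans bern; apply: ler_wpM2l => //; lra.
rewrite lerBrDr addrC -lerBrDr -(@ler_pM2r _ (1 + 49 / 100 * e2)); last by lra.
apply: le_trans bern2 _; nra.
Qed.

(** The witness is y = (l / r)^(1/3); it turns the real powers into polynomial relations. *)
Lemma cube_root_ratio r l : 0 < l -> l <= r -> exists y : R,
  [/\ 0 < y, y <= 1, r * y ^+ 3 = l &
      r `^ (4 / 3) / l `^ (1 / 3) = r / y].
Proof.
move=> l0 lr; have r0 : 0 < r by apply: lt_le_trans lr.
have cube (u : R) : 0 < u -> (u `^ (1 / 3)) ^+ 3 = u.
  move=> u0; rewrite -powR_mulrn ?powR_ge0 // -powRrM (_ : 1 / 3 * 3%:R = 1) ?powRr1 ?ltW //.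
  by field.
exists (l `^ (1 / 3) / r `^ (1 / 3)); split.
- by rewrite divr_gt0 // powR_gt0.
- rewrite ler_pdivrMr ?powR_gt0 // [1 * _ `^ _]mul1r.
  by apply: ge0_ler_powR; rewrite ?nnegrE //; lra.
- by rewrite expr_div_n !cube // mulrCA divff ?mulr1 // gt_eqF.
- have -> : r `^ (4 / 3) = r * r `^ (1 / 3).
    rewrite (_ : 4 / 3 = 1 + 1 / 3 :> R); last by field.
    by rewrite powRD ?powRr1 ?ltW // gt_eqF // implybT.
  by rewrite invf_div mulrA.
Qed.

Lemma halves_ge (n : nat) : 1000 <= n%:R :> R ->
  49 / 100 * n%:R <= n./2%:R :> R /\ 49 / 100 * n%:R <= (n - n./2)%:R :> R.
Proof.
move=> n1000.
have h1 : (n <= n./2.*2.+1)%N by rewrite -[leqLHS]odd_double_half; case: (odd n).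
have h2 : (n./2 <= n - n./2)%N by lia.
have h3 : n%:R <= 2 * n./2%:R + 1 :> R.
  by rewrite -(ler_nat R) -muln2 -addn1 natrD natrM in h1; lra.
split; first by lra.
by apply: (@le_trans _ _ n./2%:R); [lra|rewrite ler_nat].
Qed.

Lemma grid_parameters (n : nat) r : 1000 <= ln n%:R :> R -> ln n%:R <= r ->
  exists (K a : nat) (eps p mu : R),
  [/\ [/\ (0 < K)%N, (0 < a)%N, 0 < eps, K%:R * eps = r / 5 & 10 * eps <= r],
      p = eps ^+ 2 / n%:R /\ 2 * p <= 1,
      [/\ mu = (K * K)%:R * ((1 - (1 - p) ^+ n./2) * (1 - (1 - p) ^+ (n - n./2))),
          0 < mu &
          forall k : nat, k%:R < 10 ^- 4 * (r `^ (4 / 3)) / (ln n%:R `^ (1 / 3)) ->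
            (k * a)%:R <= mu / 2] &
      4 / mu + (n * n)%:R * ('C(12 * K, a)%:R * (n%:R * p) ^+ (2 * a)) <= 5 / ln n%:R].
Proof.
set l := ln n%:R => l1000 lr.
have l0 : 0 < l by lra.
have n0 : (0 < n)%N.
  by rewrite lt0n; apply/eqP => n0; move: l0; rewrite /l n0 ln0 ?ltxx.
have n0' : 0 < n%:R :> R by rewrite ltr0n.
have nl : expR l = n%:R by rewrite /l lnK // posrE.
have n1000 : 1000 <= n%:R :> R.
  by rewrite -nl; have := @expR_ge1Dx R l; lra.
have r0 : 0 < r by lra.
have [y [y0 y1 ry kE]] := cube_root_ratio l0 lr.
pose kap := 2 * r / (5 * y).
have kap0 : 0 < kap by rewrite divr_gt0 ?mulr_gt0.
have kapy : kap * y = 2 / 5 * r by rewrite /kap; field; rewrite gt_eqF.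
have kap100 : 100 <= kap.
  have : kap * y <= kap by rewrite ger_pMr.
  by move: kapy lr l1000; clear; lra.
(* Rounding up makes [eps] at most y/2; since [kap] is at least 100, it stays above y/2.02. *)
pose K := (Num.truncn kap).+1; pose a := Num.truncn (8 * l).
have /andP[K1 K2] : K%:R - 1 <= kap < K%:R.
  have /andP[h1 h2] := truncn_itv (ltW kap0).
  by rewrite h2 andbT /K -[_.+1%:R]natr1 addrK.
have /andP[a1 a2] : a%:R <= 8 * l < a%:R + 1.
  have h8 : 0 <= 8 * l by lra.
  by have /andP[h1 h2] := truncn_itv h8; rewrite h1 natr1 h2.
pose eps := r / 5 / K%:R; pose p := eps ^+ 2 / n%:R.
pose mu := (K * K)%:R * ((1 - (1 - p) ^+ n./2) * (1 - (1 - p) ^+ (n - n./2))).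
exists K, a, eps, p, mu.
have K0 : 0 < K%:R :> R by rewrite ltr0n.
have epsK : eps * K%:R = r / 5 by rewrite /eps divfK // gt_eqF.
have eps0 : 0 < eps by rewrite !divr_gt0.
have eps_le : eps <= y / 2.
  rewrite -(ler_pM2r K0) epsK.
  have : y / 2 * kap <= y / 2 * K%:R.
    by apply: ler_wpM2l (ltW K2); rewrite divr_ge0 // ltW.
  by move: kapy; clear; lra.
have eps_ge : y / (202 / 100) <= eps.
  rewrite -(ler_pM2r K0) epsK.
  have : y / (202 / 100) * K%:R <= y / (202 / 100) * (101 / 100 * kap).
    apply: ler_wpM2l; first by rewrite divr_ge0 // ltW.
    by move: K1 kap100; clear; lra.
  by move: kapy; clear; lra.
pose e2 := eps ^+ 2.
have e2p : 0 < e2 by rewrite exprn_gt0.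
have e2_le : e2 <= 1 / 4.
  have : e2 <= (1 / 2) ^+ 2.
    apply: lerXn2r; rewrite ?nnegrE ?divr_ge0 //; first exact: ltW.
    by move: eps_le y1; clear; lra.
  by rewrite (_ : (1 / 2) ^+ 2 = 1 / 4 :> R) //; field.
have e2_ge : (y / (202 / 100)) ^+ 2 <= e2.
  by apply: lerXn2r => //; rewrite nnegrE ?divr_ge0 // ltW.
have a0 : (0 < a)%N by rewrite -(ltr0n R); move: a2 l1000; clear; lra.
have np : n%:R * p = e2 by rewrite /p mulrC divfK // gt_eqF.
have halves := halves_ge n1000.
have q1 := hit_probability_ge (ltW e2p) e2_le n0 halves.1.
have q2 := hit_probability_ge (ltW e2p) e2_le n0 halves.2.
have KK : (K * K)%:R * (43 / 100 * e2 * (43 / 100 * e2)) <= mu.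
  rewrite /mu; apply: ler_wpM2l => //; apply: ler_pM => //.
  - by rewrite mulr_ge0 // ltW.
  - by rewrite mulr_ge0 // ltW.
have muge : 18 / 100 / 100 * (r * y) ^+ 2 <= mu.
  apply: le_trans KK; rewrite natrM.
  have -> : K%:R * K%:R * (43 / 100 * e2 * (43 / 100 * e2)) =
    (43 / 100) ^+ 2 * ((eps * K%:R) ^+ 2 * e2) by rewrite /e2; ring.
  rewrite epsK.
  have : (r / 5) ^+ 2 * (y / (202 / 100)) ^+ 2 <= (r / 5) ^+ 2 * e2.
    by apply: ler_wpM2l => //; exact: sqr_ge0.
  rewrite (_ : (r / 5) ^+ 2 * (y / _) ^+ 2 = 10 / 101 * (10 / 101) * (r * y) ^+ 2); last by field.
  rewrite [(43 / 100) ^+ 2]expr2.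
  by have := sqr_ge0 (r * y); clear; lra.
have rylow : l <= r * y.
  rewrite -ry; apply: ler_wpM2l; first exact: ltW.
  by rewrite -[leRHS]expr1; apply: ler_wiXn2l => //; exact: ltW.
have mul : l ^+ 2 / 1000 <= mu.
  have : l ^+ 2 <= (r * y) ^+ 2.
    by apply: lerXn2r => //; rewrite nnegrE ltW // mulr_gt0.
  by move: muge; have := sqr_ge0 l; clear; lra.
(* The factor n^2 = exp(2l) counts sensors and step numbers. The binomial tail has exponent at most
   1.2 l - a, and a > 8l - 1 absorbs both. *)
have tail : (n * n)%:R * ('C(12 * K, a)%:R * (n%:R * p) ^+ (2 * a)) <= expR (- l).
  rewrite np exprM.
  have e20 : 0 <= e2 ^+ 2 by exact: sqr_ge0.
  have tail := binomial_tail (12 * K) a e20.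
  have -> : (n * n)%:R = expR (2 * l) :> R.
    by rewrite natrM -nl -expRD; congr expR; ring.
  apply: le_trans (ler_wpM2l (expR_ge0 _) tail) _.
  rewrite -expRD ler_expR.
  have zM : e2 ^+ 2 * (12 * K)%:R <= 3 / 10 * l.
    have -> : e2 ^+ 2 * (12 * K)%:R = 12 * (eps * K%:R) * eps ^+ 3.
      by rewrite natrM /e2; ring.
    rewrite epsK -ry.
    have : eps ^+ 3 <= (y / 2) ^+ 3.
      by apply: lerXn2r => //; rewrite nnegrE ltW // divr_gt0.
    move=> h; have : 12 * (r / 5) * eps ^+ 3 <= 12 * (r / 5) * (y / 2) ^+ 3.
      by apply: ler_wpM2l => //; rewrite mulr_ge0 // divr_ge0 // ltW.
    rewrite (_ : 12 * (r / 5) * (y / 2) ^+ 3 = 3 / 10 * (r * y ^+ 3)) //; by field.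
  have : expR 1 * (e2 ^+ 2 * (12 * K)%:R) <= 4 * (3 / 10 * l).
    have z0 : 0 <= e2 ^+ 2 * (12 * K)%:R by apply: mulr_ge0.
    by apply: ler_pM; [exact: expR_ge0|exact: z0|exact: expR1_le4|exact: zM].
  by move: a2 l1000; clear; lra.
have l2 : 0 < l ^+ 2 by rewrite exprn_gt0.
have mu0 : 0 < mu by move: mul l2; clear; lra.
split.
- by split=> //; [rewrite mulrC|move: eps_le y1 lr l1000; clear; lra].
- split=> //; rewrite /p -/e2 mulrA ler_pdivrMr //.
  by move: e2_le n1000; clear; lra.
- split=> // k; rewrite -mulrA kE => hk.
  have : k%:R * a%:R <= 10 ^- 4 * (r / y) * (8 * l).
    by apply: ler_pM => //; exact: ltW.
  rewrite natrM => /le_trans; apply.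
  (* The constant 10^-4 fits here: [k * a] is at most 8/10^4 (ry)^2, while mu/2 is at least 9/10^4
     (ry)^2. *)
  have -> : 10 ^- 4 * (r / y) * (8 * l) = 8 / 100 / 100 * (r * y) ^+ 2.
    by rewrite -ry; field; rewrite gt_eqF.
  by move: muge; have := sqr_ge0 (r * y); clear; lra.
- have h1 : 4 / mu <= 4 / l.
    rewrite ler_pM2l // lef_pV2 ?posrE //; apply: le_trans mul.
    have : 0 <= l * (l - 1000).
      by apply: mulr_ge0; [exact: ltW|rewrite subr_ge0; exact: l1000].
    by clear; lra.
  have h2 : expR (- l) <= 1 / l.
    rewrite expRN div1r lef_pV2 ?posrE ?expR_gt0 //.
    by apply: le_trans (expR_ge1Dx l); rewrite lerDr.
  have h3 : 5 / l = 4 / l + 1 / l by field; rewrite gt_eqF.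
  by rewrite h3; apply: lerD h1 (le_trans tail h2).
Qed.

End Numeric.

(** * Conclusion *)

Section EvasionEvent.
Variables (R : realType) (n : nat) (r : R).
Variables (d : measure_display) (Omega : measurableType d).
Variable X : 'I_n -> {mfun Omega >-> (R * R)%type}.

Definition evasion_event : set Omega := [set w |
  let x := fun i : 'I_n => X i w in
  forall k : nat, (k.+1 < n)%N ->
    k%:R < 10 ^- 4 * (r `^ (4 / 3)) / (ln (n%:R : R) `^ (1 / 3)) ->
    robber_evades_within (torus_graph r x) k
      [set i | torus_ball n (torus_center R n) (r / 3) (x i)]].

Lemma measurable_evasion_event : measurable evasion_event.
Proof.
pose b (t : 'I_n * 'I_n + 'I_n) w : bool := match t with
  | inl ij => (ij.1 != ij.2) && (torus_dist (torus_side R n) (X ij.1 w) (X ij.2 w) <= r)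
  | inr i => torus_dist (torus_side R n) (torus_center R n) (X i w) <= r / 3 end.
pose Psi (f : 'I_n * 'I_n + 'I_n -> bool) : Prop :=
  forall k : nat, (k.+1 < n)%N ->
    k%:R < 10 ^- 4 * (r `^ (4 / 3)) / (ln (n%:R : R) `^ (1 / 3)) ->
    robber_evades_within (fun i j => f (inl (i, j))) k [set i | f (inr i)].
apply: (@measurable_finite_info _ Omega _ b Psi) => -[[i j]|i] /=.
  by apply: mpredI; [exact: mpred_cst|apply: mpred_torus_dist_le; exact: measurable_funP].
by apply: mpred_torus_dist_le; [exact: measurable_cst|exact: measurable_funP].
Qed.

Variable P : probability Omega R.
Hypothesis indX : mutually_independent P X.
Hypothesis unifX : forall i, uniform_on P (@torus_square R n) (X i).
Hypotheses (n_large : 1000 <= ln n%:R :> R) (nr : ln n%:R <= r).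

Lemma card_first_half : #|[pred i : 'I_n | (i < n./2)%N]| = n./2 /\
  #|[pred i : 'I_n | ~~ (i < n./2)%N]| = (n - n./2)%N.
Proof.
have h : (n./2 <= n)%N by rewrite -[leqRHS]odd_double_half -addnn; lia.
have e : #|[pred i : 'I_n | (i < n./2)%N]| = n./2.
  rewrite -sum1_card -(big_ord_widen n (fun=> 1%N) h).
  by rewrite sum_nat_const card_ord muln1.
split=> //; have := cardC [pred i : 'I_n | (i < n./2)%N].
rewrite e card_ord (eq_card (B := [pred i : 'I_n | ~~ (i < n./2)%N])) => [|i].
  by set c := #|_|; lia.
by rewrite !inE.
Qed.

Lemma evasion_event_small_radius : r < 5 * torus_side R n ->
  1 - 5 / ln n%:R <= pr P evasion_event.
Proof.
have := n_large; set l := ln n%:R => l1000 rs.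
have [K [a [eps [p [mu [[K0 a0 eps0 Keps epsr] [pE p2] [muE mu0 kmu] tail]]]]]] :=
  grid_parameters n_large nr.
have l0 : 0 < l by lra.
have r0 : 0 < r by have := nr; rewrite -/l; lra.
have n0 : (0 < n)%N.
  by rewrite lt0n; apply/eqP => n0; move: l0; rewrite /l n0 ln0 ?ltxx.
have n0' : 0 < n%:R :> R by rewrite ltr0n.
have K0' : 0 < K%:R :> R by rewrite ltr0n.
set s := torus_side R n in rs.
have s2 : s ^+ 2 = n%:R by rewrite sqr_sqrtr // ler0n.
(* The corner of the centred square of side r/5; it lies in the torus square because r < 5s. *)
pose lo := s / 2 - r / 10.
have lo0 : 0 <= lo by rewrite /lo; lra.
have hi : lo + K%:R * eps <= s by rewrite Keps /lo; lra.
have centered : lo + K%:R * eps / 2 = s / 2 by rewrite Keps /lo; field.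
pose C := ('I_K * 'I_K)%type.
have prS i (q : C) : pr P (X i @^-1` cell lo eps q) = p.
  rewrite pE; exact: (pr_uniform_cell (unifX i) n0 lo0 eps0 hi).
have mS (q : C) : measurable (@cell R K lo eps q) by exact: measurable_cell.
have disjS (q q' : C) x : cell lo eps q x -> cell lo eps q' x -> q = q'.
  exact: cell_disjoint.
have p0 : 0 <= p by rewrite pE divr_ge0 ?sqr_ge0 // ler0n.
have pC : #|{: C}|%:R * p <= 1.
  rewrite card_prod card_ord pE mulrA ler_pdivrMr // mul1r natrM.
  rewrite (_ : K%:R * K%:R * eps ^+ 2 = (K%:R * eps) ^+ 2); last by ring.
  rewrite Keps -s2; apply: lerXn2r; rewrite ?nnegrE; lra.
pose inc := in_cell (K := K) X lo eps.
pose few := [set w | #|double_cells (inc w)|%:R <= mu / 2].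
(* The pair is a sensor together with a number of steps. *)
pose many (im : 'I_n * 'I_n) := [set w |
  (a <= #|mixed_cells K X r lo eps im.1 im.2 (finset.set0) w :&: double_cells (inc w)|)%N].
have mfew : measurable few.
  exact: (measurable_double_cells X mS (fun D => #|D|%:R <= mu / 2)).
have mmany im : measurable (many im).
  have sM J D := @sigma_mixed_cells R d Omega n K X r lo eps im.1 im.2 J D.
  exact: (measurable_many_mixed mS _ sM).
have prfew : pr P few <= 4 / mu.
  have := pr_few_doubles indX mS disjS prS p0 pC p2 (H := fun i => (i < n./2)%N).
  have [-> ->] := card_first_half.
  by rewrite card_prod card_ord -muE; apply.
have prmany im : pr P (many im) <= 'C(12 * K, a)%:R * (n%:R * p) ^+ (2 * a).
  apply: (pr_many_mixed_doubles indX (Ordinal K0, Ordinal K0) mS disjS prS).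
  - exact: sigma_mixed_cells.
  - exact: mixed_cells_local.
  - by move=> J w; apply: card_mixed => //; rewrite Keps.
pose F (x : option ('I_n * 'I_n)) := if x is Some im then many im else few.
have cover w : (~` evasion_event) w -> exists2 x, true & F x w.
  apply: contra_notP => nob x k kn kbound.
  have nfew : ~ few w by move=> h; apply: nob; exists None.
  have nmany im : ~ many im w by move=> h; apply: nob; exists (Some im).
  apply: (@grid_evades R n K k a _ r lo eps) => //.
  - move=> i m; rewrite leqNgt; apply/negP => lt; apply: (nmany (i, m)).
    rewrite /many /=; apply: leq_trans (ltnW lt) _.
    rewrite /mixed_cells (_ : outside K X lo eps finset.set0 w =
      [pred j | ~~ [exists q, in_cell X lo eps w j (q : C)]]) //.
    by apply/funext => j; rewrite outsideE finset.in_set0.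
  - rewrite -(ltr_nat R); apply: le_lt_trans (kmu k kbound) _.
    by rewrite ltNge; apply/negP.
have bad : pr P (~` evasion_event) <= \sum_(x : option ('I_n * 'I_n)) pr P (F x).
  apply: pr_union_bound => //; last exact: measurableC measurable_evasion_event.
  by case=> [im|] _; [exact: mmany|exact: mfew].
rewrite prC in bad; last exact: measurable_evasion_event.
have sumF : \sum_(x : option ('I_n * 'I_n)) pr P (F x) <= 5 / l.
  rewrite (bigD1 None) //= (reindex_omap Some id) => [|[]//].
  apply: le_trans tail; apply: lerD => //.
  rewrite (eq_bigl xpredT) => [|im]; last by rewrite eqxx.
  apply: le_trans (ler_sum _ (fun im _ => prmany im)) _.
  by rewrite sumr_const card_prod card_ord -[leLHS]mulr_natl.
by rewrite lerBlDl -lerBlDr; exact: le_trans bad sumF.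
Qed.

Lemma evasion_event_likely : 1 - 5 / ln n%:R <= pr P evasion_event.
Proof.
have [|rs] := ltP r (5 * torus_side R n); first exact: evasion_event_small_radius.
have -> : evasion_event = setT.
  by apply/seteqP; split=> // w _ x k kn _; exact: (complete_evades _ rs kn).
by rewrite /pr probability_setT /= gerBl divr_ge0 //; have := n_large; lra.
Qed.

End EvasionEvent.

(* k.+1 < n: on any graph with n vertices, n - 1 distinct sensors locate the
   robber in the first round.  The condition only matters for r far above the
   diameter of the torus; for r <= sqrt (2 n) and n >= 2 it follows from the
   bound on k. *)
Theorem theorem4p1 (R : realType) (r : nat -> R)
  (hr : forall n : nat, (0 < n)%N -> ln (n%:R : R) <= r n)
  (d : nat -> measure_display) (Omega : forall n : nat, measurableType (d n))
  (P : forall n : nat, probability (Omega n) R)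
  (X : forall n : nat, 'I_n -> {mfun Omega n >-> (R * R)%type})
  (hind : forall n : nat, mutually_independent (P n) (X n))
  (hunif : forall (n : nat) (i : 'I_n),
      uniform_on (P n) (torus_square n) (X n i)) :
  aas P (fun n : nat => [set w : Omega n |
    let x := fun i : 'I_n => X n i w in
    forall k : nat, (k.+1 < n)%N ->
      k%:R < 10 ^- 4 * (r n `^ (4 / 3)) / (ln (n%:R : R) `^ (1 / 3)) ->
      robber_evades_within (torus_graph (r n) x) k
        [set i | torus_ball n (torus_center R n) (r n / 3) (x i)]]).
Proof.
have mA n : measurable (evasion_event (r n) (X n)) by exact: measurable_evasion_event.
split; first exact: mA.
apply/fine_cvgP; split; first by apply: nearW => n; rewrite fin_num_measure //; exact: mA.
apply/cvgrPdist_le => e e0; near=> n.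
(* The 1000 serves the choice of parameters, and 5/e brings the failure probability 5 / ln n below
   [e]. *)
have n_large : expR (1000 + 5 / e) <= n%:R :> R by near: n; exact: nbhs_infty_ger.
have n0' : 0 < n%:R :> R by apply: lt_le_trans n_large; exact: expR_gt0.
have lnn : 1000 + 5 / e <= ln n%:R.
  by rewrite -[leLHS]expRK ler_ln ?posrE ?expR_gt0.
have e5 : 0 < 5 / e by rewrite divr_gt0.
have l0 : 0 < ln n%:R :> R by lra.
have := @evasion_event_likely R n (r n) _ _ (X n) (P n) (hind n) (hunif n).
move=> /(_ _ (hr n _)); rewrite -(ltr0n R) => /(_ _ n0') low.
rewrite /= -/(pr (P n) (evasion_event (r n) (X n))).
rewrite ger0_norm; last by rewrite subr_ge0; exact: pr_le1.
have : 5 / ln n%:R <= e by rewrite ler_pdivrMr // mulrC -ler_pdivrMr //; lra.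
have : 1 - 5 / ln n%:R <= pr (P n) (evasion_event (r n) (X n)) by apply: low; lra.
lra.
Unshelve. all: by end_near.
Qed.
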